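(* Let $\Delta \ge 1$ and consider combinatorial auctions with bidder and item conflicts in which the bidder conflict graph $G$ has maximum out-degree $\Delta$ and the item conflict graph $G_I$ is arbitrary. Given a deterministic $\alpha$-approximation algorithm $f$ for combinatorial auctions without conflicts, there exists a deterministic $(16\Delta\alpha/3)$-approximation algorithm $f^c$ for combinatorial auctions with bidder and item conflicts. Moreover, if $f$ is maximal-in-range, then $f^c$ can be chosen to be maximal-in-range and truthful.
   Context: Combinatorial auction (CA): a finite set $B$ of $n$ bidders and a finite set $I$ of $m$ items; each bidder $i\in B$ has a valuation $v_i:2^I\to\mathbb{R}_{\ge 0}$. An allocation is a tuple $S=(S_i)_{i\in B}$ of pairwise disjoint subsets of $I$ (not all items need be assigned). Without conflicts, the social welfare of $S$ is $\sum_{i\in B} v_i(S_i)$. CA with bidder and item conflicts: additionally there are directed graphs $G=(B,E)$ (bidder conflict graph) and $G_I=(I,E_I)$ (item conflict graph), which are public. For an allocation $S$, bidder $i$ has the set of useless items $D_i=\{k\in S_i \mid \exists j\in B,\ \exists \ell\in S_j:\ (i,j)\in E \text{ and } (k,\ell)\in E_I\}$, and $v_i^c(S)=v_i(S_i\setminus D_i)$. The social welfare is $SW(S)=\sum_{i\in B} v_i^c(S)$. An $\alpha$-approximation algorithm outputs, for every instance, an allocation whose social welfare is at least $1/\alpha$ times the maximum social welfare over all allocations (of the respective problem). An algorithm $f$ is maximal-in-range if there is a subset $A'$ of the set $A$ of allocations (not depending on the valuations) such that $f(v_1,\dots,v_n)\in\arg\max_{S\in A'}\sum_{i\in B} v_i(S)$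 for all valuations, where $v_i(S)$ is bidder $i$'s value for allocation $S$ (i.e. $v_i(S_i)$ without conflicts, $v_i^c(S)$ with conflicts). An algorithm is truthful if there is a payment scheme $p$ such that reporting the true valuation $v_i$ is a dominant strategy for each bidder $i$, whose utility is the value of the allocation minus the payment $p_i$. Algorithms are polynomial-time: if $f$ runs in polynomial time, then $f^c$ (which uses $f$ as a subroutine) is required to run in polynomial time. *)

(* Defs.v *)
From HB Require Import structures.
From mathcomp Require Import all_boot all_order all_algebra.
From mathcomp Require Import interval_inference reals.

Set Implicit Arguments.
Unset Strict Implicit.
Unset Printing Implicit Defensive.

Import Order.TTheory GRing.Theory Num.Theory.
Local Open Scope ring_scope.

(* Bidders are ['I_n], items are ['I_m]. *)
Definition valuation (R : realType) (m : nat) := {set 'I_m} -> {nonneg R}.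
Definition profile (R : realType) (n m : nat) := 'I_n -> valuation R m.
Definition bundles (n m : nat) := {ffun 'I_n -> {set 'I_m}}.

Definition is_allocation n m (S : bundles n m) : bool :=
  [forall i, forall j, (i != j) ==> [disjoint S i & S j]].

Definition useless n m (E : rel 'I_n) (EI : rel 'I_m) (S : bundles n m)
    (i : 'I_n) : {set 'I_m} :=
  [set k in S i | [exists j, exists l, [&& l \in S j, E i j & EI k l]]].

(* Arcs are ordered pairs of distinct bidders.  A loop at [i] would let the
   items of [i] destroy one another, so that even a one-bidder auction would
   contain the maximum independent set problem on the item graph. *)
Definition bidder_graph n (Delta : nat) (E : rel 'I_n) : Prop :=
  irreflexive E /\ (\max_i #|[set j | E i j]| <= Delta)%N.

(* [val i w S] is the value of allocation [S] for bidder [i] when the valuation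
   of [i] is [w]; the solution concepts below are common to both problems. *)
Definition value_fun (R : realType) (n m : nat) :=
  'I_n -> valuation R m -> bundles n m -> R.

Definition plain_value (R : realType) n m : value_fun R n m :=
  fun i w S => (w (S i))%:num.

Definition conflict_value (R : realType) n m (E : rel 'I_n) (EI : rel 'I_m) :
    value_fun R n m :=
  fun i w S => (w (S i :\: useless E EI S i))%:num.

Definition welfare (R : realType) n m (val : value_fun R n m)
    (v : profile R n m) (S : bundles n m) : R :=
  \sum_i val i (v i) S.

(* The base value 0 is harmless: welfare is nonnegative and there is always an
   allocation, the one that assigns no item. *)
Definition max_welfare (R : realType) n m (val : value_fun R n m)
    (v : profile R n m) : R :=
  \big[Num.max/0]_(S : bundles n m | is_allocation S) welfare val v S.

Definition approximates (R : realType) n m (val : value_fun R n m) (alpha : R)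
    (F : profile R n m -> bundles n m) : Prop :=
  forall v, is_allocation (F v) /\
            alpha^-1 * max_welfare val v <= welfare val v (F v).

Definition maximal_in_range (R : realType) n m (val : value_fun R n m)
    (F : profile R n m -> bundles n m) : Prop :=
  exists A' : {set bundles n m},
    (forall S, S \in A' -> is_allocation S) /\
    forall v, F v \in A' /\
              forall S, S \in A' -> welfare val v S <= welfare val v (F v).

Definition report (R : realType) n m (v : profile R n m) (i : 'I_n)
    (w : valuation R m) : profile R n m :=
  fun j => if j == i then w else v j.

Definition truthful (R : realType) n m (val : value_fun R n m)
    (F : profile R n m -> bundles n m) : Prop :=
  exists p : 'I_n -> profile R n m -> R,
    forall (i : 'I_n) (v : profile R n m) (w : valuation R m),
      val i (v i) (F (report v i w)) - p i (report v i w)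
        <= val i (v i) (F v) - p i v.

(* Deterministic WHILE programs over binary trees whose leaves may carry real
   numbers.  Tree operations, real arithmetic and comparison, and queries to
   bidders have unit cost; there is no way to read off the digits of a real
   number other than by arithmetic and comparison. *)
Inductive data (R : Type) : Type :=
| Nil
| Num of R
| Pair of data R & data R.
Arguments Nil {R}.

(* The only numerals are 0 and 1, so a program carries no real parameter. *)
Inductive expr : Type :=
| Var of nat
| ENil
| EPair of expr & expr
| EFst of expr
| ESnd of expr
| EIsNum of expr
| EZero
| EOne
| EAdd of expr & expr
| ESub of expr & expr
| EMul of expr & expr
| EDiv of expr & expr
| ELe of expr & expr.

(* [Query x e1 e2] stores in [x] the answer of bidder [e1] to query [e2]. *)
Inductive cmd : Type :=
| Skip
| Assign of nat & expr
| Query of nat & expr & expr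
| Seq of cmd & cmd
| If of expr & cmd & cmd
| While of expr & cmd.

Definition store (R : Type) := nat -> data R.

Definition set_var (R : Type) (s : store R) (x : nat) (d : data R) : store R :=
  fun y => if y == x then d else s y.

Definition truthy (R : Type) (d : data R) : bool :=
  if d is Nil then false else true.

Definition code_bool (R : Type) (b : bool) : data R :=
  if b then Pair Nil Nil else Nil.

Definition num_of (R : realType) (d : data R) : R :=
  if d is Num r then r else 0.

Fixpoint eval (R : realType) (s : store R) (e : expr) : data R :=
  match e with
  | Var x => s x
  | ENil => Nil
  | EPair e1 e2 => Pair (eval s e1) (eval s e2)
  | EFst e1 => if eval s e1 is Pair a _ then a else Nil
  | ESnd e1 => if eval s e1 is Pair _ b then b else Nil
  | EIsNum e1 => code_bool R (if eval s e1 is Num _ then true else false)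
  | EZero => Num 0
  | EOne => Num 1
  | EAdd e1 e2 => Num (num_of (eval s e1) + num_of (eval s e2))
  | ESub e1 e2 => Num (num_of (eval s e1) - num_of (eval s e2))
  | EMul e1 e2 => Num (num_of (eval s e1) * num_of (eval s e2))
  | EDiv e1 e2 => Num (num_of (eval s e1) / num_of (eval s e2))
  | ELe e1 e2 => code_bool R (num_of (eval s e1) <= num_of (eval s e2))
  end.

(* Indices and sizes are written in unary, subsets and relations as bit lists
   and bit matrices; every encoding below has size polynomial in n + m. *)
Fixpoint code_nat (R : Type) (k : nat) : data R :=
  if k is k'.+1 then Pair Nil (code_nat R k') else Nil.

Definition code_list (R : Type) (l : seq (data R)) : data R :=
  foldr (@Pair R) Nil l.

Definition code_set (R : Type) m (A : {set 'I_m}) : data R :=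
  code_list [seq code_bool R (k \in A) | k <- enum 'I_m].

Definition code_rel (R : Type) n (E : rel 'I_n) : data R :=
  code_list [seq code_set R [set j | E i j] | i <- enum 'I_n].

Definition code_bundles (R : Type) n m (S : bundles n m) : data R :=
  code_list [seq code_set R (S i) | i <- enum 'I_n].

Definition code_plain (R : Type) (n m : nat) : data R :=
  Pair (code_nat R n) (code_nat R m).

Definition code_conflict (R : Type) n m (E : rel 'I_n) (EI : rel 'I_m) :
    data R :=
  Pair (code_plain R n m) (Pair (code_rel R E) (code_rel R EI)).

(* [exec ask c s s' t]: started in [s], the command [c] terminates in [s'] after
   [t] steps.  A query addressed to anything but the code of a bidder blocks. *)
Inductive exec (R : realType) n (ask : 'I_n -> data R -> data R) :
    cmd -> store R -> store R -> nat -> Prop :=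
| exec_skip s : exec ask Skip s s 1
| exec_assign x e s : exec ask (Assign x e) s (set_var s x (eval s e)) 1
| exec_query x e1 e2 s (i : 'I_n) of eval s e1 = code_nat R i :
    exec ask (Query x e1 e2) s (set_var s x (ask i (eval s e2))) 1
| exec_seq c1 c2 s s1 s2 t1 t2 of
    exec ask c1 s s1 t1 & exec ask c2 s1 s2 t2 :
    exec ask (Seq c1 c2) s s2 (t1 + t2)
| exec_if_true e c1 c2 s s' t of truthy (eval s e) & exec ask c1 s s' t :
    exec ask (If e c1 c2) s s' t.+1
| exec_if_false e c1 c2 s s' t of ~~ truthy (eval s e) & exec ask c2 s s' t :
    exec ask (If e c1 c2) s s' t.+1
| exec_while_false e c s of ~~ truthy (eval s e) :
    exec ask (While e c) s s 1
| exec_while_true e c s s1 s2 t1 t2 of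
    truthy (eval s e) & exec ask c s s1 t1 & exec ask (While e c) s1 s2 t2 :
    exec ask (While e c) s s2 (t1 + t2).+1.

Lemma code_nat_inj (R : Type) : injective (code_nat R).
Proof. by elim=> [|k IH] [|l] //= [/IH ->]. Qed.

Lemma exec_det (R : realType) n (ask : 'I_n -> data R -> data R) c s s1 t1 :
  exec ask c s s1 t1 -> forall s2 t2, exec ask c s s2 t2 -> s1 = s2 /\ t1 = t2.
Proof.
elim=> {c s s1 t1}.
- by move=> s s2 t2 H; inversion H.
- by move=> x e s s2 t2 H; inversion H.
- move=> x e1 e2 s i Hi s2 t2 H; inversion H as [| |x' e1' e2' s' j Hj| | | | |].
  by have -> : i = j by apply/val_inj/(@code_nat_inj R); rewrite -Hi -Hj.
- move=> c1 c2 s s1 s2 t1 t2 _ IH1 _ IH2 s3 t3 H.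
  inversion H as [| | |c1' c2' s' s1' s2' t1' t2' H1 H2| | | |]; subst.
  by have [? ?] := IH1 _ _ H1; subst; have [-> ->] := IH2 _ _ H2.
- move=> e c1 c2 s s1 t1 He _ IH s3 t3 H; inversion H as [| | | |? ? ? ? ? t' ? H1|? ? ? ? ? t' H0 H1| |]; subst.
    by have [-> ->] := IH _ _ H1.
  by rewrite He in H0.
- move=> e c1 c2 s s1 t1 He _ IH s3 t3 H; inversion H as [| | | |? ? ? ? ? t' H0 H1|? ? ? ? ? t' ? H1| |]; subst.
    by rewrite H0 in He.
  by have [-> ->] := IH _ _ H1.
- move=> e c s He s3 t3 H; inversion H as [| | | | | | |? ? ? ? ? ? ? H0]; subst=> //.
  by rewrite H0 in He.
- move=> e c s s1 s2 t1 t2 He _ IH1 _ IH2 s3 t3 H.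
  inversion H as [| | | | | |? ? ? H0|? ? ? ? ? ? ? ? H1 H2]; subst.
    by rewrite He in H0.
  by have [? ?] := IH1 _ _ H1; subst; have [-> ->] := IH2 _ _ H2.
Qed.

(* A query model fixes which queries bidders answer, and how.  It must contain
   value queries; it may also offer demand queries, or disclose a valuation in
   some bidding language. *)
Definition query_model (R : realType) :=
  forall m, valuation R m -> data R -> data R.

Definition has_value_queries (R : realType) (Q : query_model R) : Prop :=
  forall m (w : valuation R m) (A : {set 'I_m}),
    Q m w (Pair Nil (code_set R A)) = Num (w A)%:num.

Definition init_store (R : Type) (input : data R) : store R :=
  set_var (fun=> Nil) 0%N input.

(* Variable 0 holds the input at the start and the output at the end. *)
Definition run (R : realType) (Q : query_model R) (P : cmd) n m
    (v : profile R n m) (input output : data R) (t : nat) : Prop :=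
  exists2 s', exec (fun i => Q m (v i)) P (init_store input) s' t
            & s' 0%N = output.

Definition plain_rule (R : realType) :=
  forall n m, profile R n m -> bundles n m.

Definition conflict_rule (R : realType) :=
  forall n m, rel 'I_n -> rel 'I_m -> profile R n m -> bundles n m.

Definition computes_plain (R : realType) (Q : query_model R) (P : cmd)
    (F : plain_rule R) : Prop :=
  forall n m (v : profile R n m),
    exists t, run Q P v (code_plain R n m) (code_bundles R (F n m v)) t.

Definition polytime_plain (R : realType) (Q : query_model R) (P : cmd) : Prop :=
  exists p : {poly nat}, forall n m (v : profile R n m),
    exists out t, run Q P v (code_plain R n m) out t /\ (t <= p.[(n + m)%N])%N.

Definition computes_conflict (R : realType) (Q : query_model R) (Delta : nat)
    (P : cmd) (F : conflict_rule R) : Prop :=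
  forall n m (E : rel 'I_n) (EI : rel 'I_m) (v : profile R n m),
    bidder_graph Delta E ->
    exists t, run Q P v (code_conflict R E EI)
                        (code_bundles R (F n m E EI v)) t.

Definition polytime_conflict (R : realType) (Q : query_model R) (Delta : nat)
    (P : cmd) : Prop :=
  exists p : {poly nat},
  forall n m (E : rel 'I_n) (EI : rel 'I_m) (v : profile R n m),
    bidder_graph Delta E ->
    exists out t, run Q P v (code_conflict R E EI) out t /\
                  (t <= p.[(n + m)%N])%N.

(* Main.v *)
(* If every out-degree is at most Delta, then in every set of bidders the sum of
   all in- and out-degrees is at most 2 Delta per bidder, so that the bidder graph
   is 2 Delta-degenerate and has a proper colouring with 2 Delta + 1 <= 16 Delta / 3
   classes, found by first fit along a degeneracy order.  Bidders of one class
   never make each other's items useless, so the given algorithm, run on a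
   single class, solves the auction with conflicts restricted to that class.  The
   best class carries at least a fraction 1 / (2 Delta + 1) of the optimum.
   Taking the best of finitely many maximal-in-range allocations is again
   maximal in range, and VCG payments make the outcome truthful. *)
From mathcomp Require Import all_boot all_order all_algebra.
From mathcomp Require Import interval_inference reals boolp.
From mathcomp Require Import zify ring lra.
(* After MathComp, whose Nil and Num would otherwise hide the data constructors. *)
Require Import Defs.
Import Order.TTheory GRing.Theory Num.Theory.
Local Open Scope ring_scope.

Set Implicit Arguments.
Unset Strict Implicit.
Unset Printing Implicit Defensive.

(** * Colouring the bidder graph *)

(** A bound on out-degrees leaves single in-degrees unbounded, so colouring greedily in an arbitrary
    order fails; only the average over a set of bidders is controlled, hence the degeneracy order.
    The classes depend on the bidder graph alone, which keeps the range fixed when reports change.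
    Each sub-auction keeps all [m] items, so the ratio [alpha m] carries over. The larger burden is
    computational. The given algorithm is a program that names its bidders [0, ..., size C - 1], so
    it has to be simulated inside another program: its registers are moved, its queries are
    renumbered through a list of the class, and its leftovers are wiped between two runs. To make
    this tractable, the colouring and the choice of the best class are written as left folds with
    explicit accumulators, which the loops of the program follow step by step. Accumulated lists
    come out reversed, which is why many statements hold only up to permutation. *)

Definition hits n (E : rel 'I_n) (v : 'I_n) (C : seq 'I_n) : nat :=
  (\sum_(u <- C) (E v u + E u v))%N.

Definition search_step n (E : rel 'I_n) d R (a : option 'I_n * seq 'I_n) u :=
  if a.1 is Some _ then (a.1, u :: a.2)
  else if (hits E u R <= d)%N then (Some u, a.2) else (None, u :: a.2).

Definition search n (E : rel 'I_n) d R :=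
  foldl (search_step E d R) (None, [::]) R.

(** The last argument is ignored: the list folded over by [peel] only fixes the number of rounds,
    one per bidder. *)
Definition peel_step n (E : rel 'I_n) d (a : seq 'I_n * seq 'I_n) (_ : 'I_n) :=
  let b := search E d a.1 in (b.2, if b.1 is Some v then v :: a.2 else a.2).

Definition peel n (E : rel 'I_n) d V := (foldl (peel_step E d) (V, [::]) V).2.

(** The flag [a.1] says whether the bidder still waits for a class. *)
Definition place_step n (E : rel 'I_n) v
    (a : bool * seq (seq 'I_n)) (C : seq 'I_n) :=
  if a.1 then (if hits E v C == 0%N then (false, (v :: C) :: a.2)
               else (true, C :: a.2))
  else (false, C :: a.2).

Definition place n (E : rel 'I_n) Cs v :=
  (foldl (place_step E v) (true, [::]) Cs).2.

Definition colour n (E : rel 'I_n) d (V : seq 'I_n) :=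
  foldl (place E) (nseq d.+1 [::]) (peel E d V).

(* [st] is a stack: a bidder in it was removed when [R] and the bidders above it
   were still present. *)
Fixpoint sparse n (E : rel 'I_n) d (R st : seq 'I_n) : bool :=
  if st is v :: st' then (hits E v R <= d)%N && sparse E d (v :: R) st'
  else true.

Lemma hits_perm n (E : rel 'I_n) v C D :
  perm_eq C D -> hits E v C = hits E v D.
Proof. by move=> H; apply: perm_big. Qed.

Lemma hits_cons n (E : rel 'I_n) v u C :
  hits E v (u :: C) = (E v u + E u v + hits E v C)%N.
Proof. by rewrite /hits big_cons. Qed.

Lemma sparse_perm n (E : rel 'I_n) d st R R' :
  perm_eq R R' -> sparse E d R st = sparse E d R' st.
Proof.
elim: st R R' => //= v st IH R R' H.
by rewrite (hits_perm E v H) (IH _ (v :: R')) // perm_cons.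
Qed.

(** * Degree counting and the degeneracy order *)

Lemma count_out_neighbours n Delta (E : rel 'I_n) u (R : seq 'I_n) :
  bidder_graph Delta E -> uniq R -> (\sum_(w <- R) E u w <= Delta)%N.
Proof.
move=> [_ Hd] uR; apply: leq_trans Hd; apply: leq_trans (leq_bigmax u).
rewrite -big_mkcond /= sum1_count -size_filter -(card_uniqP _).
  by apply/subset_leq_card/subsetP => w; rewrite inE mem_filter => /andP[].
exact: filter_uniq.
Qed.

(** Exchanging the two sums turns the in-degrees inside [R] into out-degrees, so both halves obey
    the same bound. *)
Lemma sum_hits n Delta (E : rel 'I_n) (R : seq 'I_n) :
  bidder_graph Delta E -> uniq R ->
  (\sum_(u <- R) hits E u R <= Delta.*2 * size R)%N.
Proof.
move=> HE uR; rewrite /hits.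
under eq_bigr do rewrite big_split.
rewrite big_split /= [X in (_ + X)%N]exchange_big /= addnn -!muln2.
rewrite mulnAC leq_mul2r /=.
have -> : (Delta * size R = \sum_(u <- R) Delta)%N.
  by rewrite big_const_seq iter_addn_0 count_predT.
by apply: leq_sum => u _; apply: count_out_neighbours.
Qed.

Lemma search_found n (E : rel 'I_n) d R s v r :
  foldl (search_step E d R) (Some v, r) s = (Some v, catrev s r).
Proof. by elim: s r => //= u s IH r; rewrite /search_step /= IH. Qed.

Lemma search_spec n (E : rel 'I_n) d R s r :
  has (fun u => hits E u R <= d)%N s ->
  exists v r', [/\ foldl (search_step E d R) (None, r) s = (Some v, r'),
     perm_eq (v :: r') (s ++ r) & (hits E v R <= d)%N].
Proof.
elim: s r => //= u s IH r; rewrite {2}/search_step /=.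
case: ifPn => Hu /= H.
  exists u, (catrev s r); rewrite search_found; split=> //.
  by rewrite perm_cons catrevE perm_cat2r perm_rev.
have [v [r' [-> Hp Hv]]] := IH (u :: r) H.
exists v, r'; split=> //; apply: perm_trans Hp _.
by rewrite perm_catC /= perm_cons perm_catC.
Qed.

Lemma search_sparse n Delta (E : rel 'I_n) R :
  bidder_graph Delta E -> uniq R -> R != [::] ->
  exists v r, [/\ search E Delta.*2 R = (Some v, r), perm_eq (v :: r) R
    & (hits E v r <= Delta.*2)%N].
Proof.
move=> HE uR R0.
(* Averaging: [Delta.*2 + 1] or more hits for every bidder would sum to more than
   [Delta.*2 * size R], because [R] is not empty. *)
have H : has (fun u => hits E u R <= Delta.*2)%N R.
  apply/negP => /negP/hasPn H; have := sum_hits HE uR.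
  apply/negP; rewrite -ltnNge.
  have -> : (Delta.*2 * size R = \sum_(u <- R) Delta.*2)%N.
    by rewrite big_const_seq iter_addn_0 count_predT.
  have : (\sum_(u <- R) (Delta.*2 + 1) <= \sum_(u <- R) hits E u R)%N.
    rewrite !big_seq; apply: leq_sum => u /H /=; rewrite -ltnNge; lia.
  rewrite big_split /= [X in (_ + X)%N]big_const_seq iter_addn_0 count_predT.
  by case: R R0 {uR H} => //= *; lia.
have [v [r [Hs Hp Hv]]] := search_spec [::] H.
exists v, r; split=> //; first by rewrite cats0 in Hp.
apply: leq_trans Hv; rewrite cats0 in Hp.
by rewrite -(hits_perm _ _ Hp) hits_cons leq_addl.
Qed.

(** [r] stands for the rounds still to run. Its length equals the number of bidders left, so every
    round starts from a nonempty list. *)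
Definition peel_inv n (E : rel 'I_n) d V (r : seq 'I_n)
    (a : seq 'I_n * seq 'I_n) : bool :=
  [&& size a.1 == size r, sparse E d a.1 a.2 & perm_eq (a.1 ++ a.2) V].

Lemma peel_inv_step n Delta (E : rel 'I_n) V r u a :
  bidder_graph Delta E -> uniq V -> peel_inv E Delta.*2 V (u :: r) a ->
  exists v R', search E Delta.*2 a.1 = (Some v, R') /\
    peel_inv E Delta.*2 V r (R', v :: a.2).
Proof.
case: a => R st HE uV /and3P[/= /eqP sR Hst HV].
have : uniq (R ++ st) by rewrite (perm_uniq HV).
rewrite cat_uniq => /andP[uR _].
have R0 : R != [::] by case: (R) sR.
have [v [R' [Hs Hp Hv]]] := search_sparse HE uR R0.
exists v, R'; split=> //; apply/and3P; split => /=.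
- by have /= := perm_size Hp; rewrite sR => -[->].
- by rewrite Hv (sparse_perm _ _ _ Hp).
- apply: perm_trans HV; rewrite -cat1s perm_catCA catA perm_cat2r.
  exact: Hp.
Qed.

Lemma peel_run n Delta (E : rel 'I_n) V r a :
  bidder_graph Delta E -> uniq V -> peel_inv E Delta.*2 V r a ->
  peel_inv E Delta.*2 V [::] (foldl (peel_step E Delta.*2) a r).
Proof.
move=> HE uV; elim: r a => //= u r IH a Ha; apply: IH.
have [v [R' [Hs]]] := peel_inv_step HE uV Ha.
by rewrite /peel_step Hs.
Qed.

Lemma peel_spec n Delta (E : rel 'I_n) V :
  bidder_graph Delta E -> uniq V ->
  sparse E Delta.*2 [::] (peel E Delta.*2 V) /\
  perm_eq (peel E Delta.*2 V) V.
Proof.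
move=> HE uV; have := @peel_run _ _ E V V (V, [::]) HE uV.
rewrite /peel; case: foldl => R st; rewrite {1}/peel_inv /= eqxx cats0 perm_refl.
by move=> /(_ isT)/and3P[/= /nilP-> ].
Qed.

(** * First-fit colouring *)

Definition independent n (E : rel 'I_n) (C : seq 'I_n) : Prop :=
  {in C &, forall u w, ~~ E u w}.

Lemma place_placed n (E : rel 'I_n) v Cs D :
  foldl (place_step E v) (false, D) Cs = (false, catrev Cs D).
Proof. by elim: Cs D => //= C Cs IH D; rewrite IH. Qed.

Lemma place_spec n (E : rel 'I_n) v Cs :
  has (fun C => hits E v C == 0%N) Cs ->
  exists C Cs', [/\ perm_eq (C :: Cs') Cs, hits E v C = 0%N
    & perm_eq (place E Cs v) ((v :: C) :: Cs')].
Proof.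
rewrite /place => H.
suff : forall D, exists C Cs', [/\ perm_eq (C :: Cs') (Cs ++ D), hits E v C = 0%N
    & perm_eq (foldl (place_step E v) (true, D) Cs).2 ((v :: C) :: Cs')].
  by move=> /(_ [::]); rewrite cats0.
elim: Cs H => //= C Cs IH H D; move: H; rewrite {2}/place_step /=.
case: ifPn => [/eqP HC _ | HC /= H].
  exists C, (catrev Cs D); rewrite place_placed; split=> //=.
    by rewrite perm_cons catrevE perm_cat2r perm_rev.
  by rewrite !catrevE perm_catC /= perm_cons perm_catC.
have [C' [Cs' [H1 H2 H3]]] := IH H (C :: D).
exists C', Cs'; split=> //; apply: perm_trans H1 _.
by rewrite perm_catC /= perm_cons perm_catC.
Qed.

Lemma hits_flatten n (E : rel 'I_n) v Cs :
  hits E v (flatten Cs) = (\sum_(C <- Cs) hits E v C)%N.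
Proof. by rewrite /hits big_flatten. Qed.

Lemma perm_flatten (T : eqType) (s t : seq (seq T)) :
  perm_eq s t -> perm_eq (flatten s) (flatten t).
Proof.
by move=> H; apply/permP => a; rewrite !count_flatten !sumnE !big_map (perm_big _ H).
Qed.

Definition colouring n (E : rel 'I_n) d D (Cs : seq (seq 'I_n)) : Prop :=
  [/\ size Cs = d.+1, perm_eq (flatten Cs) D &
      forall C, C \in Cs -> independent E C].

(** Pigeonhole: the hits of [v] add up over the [d.+1] classes to at most [d], so some class has
    none. *)
Lemma place_colouring n (E : rel 'I_n) d D Cs v :
  irreflexive E -> (hits E v D <= d)%N -> colouring E d D Cs ->
  colouring E d (v :: D) (place E Cs v).
Proof.
move=> Ei Hv [sC pC iC].
have H : has (fun C => hits E v C == 0%N) Cs.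
  apply/negP => /negP/hasPn H; move: Hv; apply/negP; rewrite -ltnNge.
  rewrite -(hits_perm _ _ pC) hits_flatten -sC.
  have -> : (size Cs = \sum_(C <- Cs) 1)%N by rewrite sum1_size.
  by rewrite !big_seq; apply: leq_sum => C /H; rewrite -lt0n.
have [C [Cs' [H1 H2 H3]]] := place_spec H.
split.
- by rewrite (perm_size H3) -sC -(perm_size H1).
- apply: perm_trans (perm_flatten H3) _; rewrite /= perm_cons.
  exact: perm_trans (perm_flatten H1) pC.
move=> C'; rewrite (perm_mem H3) inE => /predU1P[->|HC']; last first.
  by apply: iC; rewrite -(perm_mem H1) inE HC' orbT.
have iC0 : independent E C by apply: iC; rewrite -(perm_mem H1) mem_head.
have vC u : u \in C -> ~~ E v u /\ ~~ E u v.
  move=> uC; have := H2; rewrite /hits => /eqP; rewrite sum_nat_seq_eq0 => /allP.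
  by move=> /(_ u uC); rewrite implyTb addn_eq0 !eqb0 => /andP.
move=> u w; rewrite !inE => /predU1P[->|Hu] /predU1P[->|Hw].
- by rewrite Ei.
- by case: (vC w Hw).
- by case: (vC u Hu).
- exact: iC0.
Qed.

Lemma colour_spec n Delta (E : rel 'I_n) V :
  bidder_graph Delta E -> uniq V ->
  colouring E Delta.*2 V (colour E Delta.*2 V).
Proof.
move=> HE uV; have [sp pV] := peel_spec HE uV.
(* Bidders return in the reverse order of their removal, so those already coloured are exactly the
   ones against which [sparse] counts hits. *)
suff H : forall st D Cs, sparse E Delta.*2 D st -> colouring E Delta.*2 D Cs ->
    colouring E Delta.*2 (catrev st D) (foldl (place E) Cs st).
  have [|s p i] := H _ _ (nseq Delta.*2.+1 [::]) sp.
    split; first by rewrite size_nseq.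
      by elim: (Delta.*2.+1).
    by move=> C; rewrite mem_nseq => /eqP ->.
  split=> //; apply: perm_trans p _; apply: perm_trans pV.
  by rewrite catrevE cats0 perm_rev.
elim=> //= v st IH D Cs /andP[Hv Hst] HC; apply: IH => //.
by apply: place_colouring => //; case: HE.
Qed.

(** * The best class *)

Definition subprofile (R : realType) n m (v : profile R n m) (C : seq 'I_n) :
    profile R (size C) m := fun j => v (tnth (in_tuple C) j).
Arguments subprofile {R n m} v C j.

Definition extend n m (C : seq 'I_n) (T : bundles (size C) m) : bundles n m :=
  [ffun i => if insub (index i C) is Some j then T j else set0].

Definition class_bundles (R : realType) (F : plain_rule R) n m
    (v : profile R n m) (C : seq 'I_n) : bundles n m :=
  extend (F (size C) m (subprofile v C)).

Definition better (R : realType) n m (v : profile R n m)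
    (a : option (bundles n m)) (S : bundles n m) : option (bundles n m) :=
  if a is Some S0 then
    if welfare (@plain_value R n m) v S0 <= welfare (@plain_value R n m) v S
    then Some S else a
  else Some S.

Definition best (R : realType) n m (v : profile R n m) Ss : bundles n m :=
  odflt [ffun=> set0] (foldl (better v) None Ss).

(** The reversed order is the one in which the program, consing one bidder after another, lists
    them. *)
Definition classes n (E : rel 'I_n) Delta : seq (seq 'I_n) :=
  colour E Delta.*2 (rev (enum 'I_n)).

Definition best_class_rule (R : realType) (F : plain_rule R) (Delta : nat) :
    conflict_rule R := fun n m E EI v =>
  best v [seq class_bundles F v C | C <- classes E Delta].

Lemma classesP n Delta (E : rel 'I_n) : bidder_graph Delta E ->
  [/\ size (classes E Delta) = Delta.*2.+1,
      perm_eq (flatten (classes E Delta)) (enum 'I_n),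
      forall C, C \in classes E Delta -> independent E C &
      forall C, C \in classes E Delta -> uniq C].
Proof.
move=> HE; have uV : uniq (rev (enum 'I_n)) by rewrite rev_uniq enum_uniq.
have [sC pC iC] := colour_spec HE uV; split=> //.
  by apply: perm_trans pC _; rewrite perm_rev.
move=> C HC; have : uniq (flatten (classes E Delta)) by rewrite (perm_uniq pC).
rewrite /classes in HC *; elim: (colour _ _ _) HC => //= D Ds IH.
by rewrite inE cat_uniq => /predU1P[->|/IH H] /and3P[].
Qed.

Lemma extend_tnth n m (C : seq 'I_n) (T : bundles (size C) m) j :
  uniq C -> extend T (tnth (in_tuple C) j) = T j.
Proof.
move=> uC; rewrite ffunE (tnth_nth (tnth (in_tuple C) j)) index_uniq //.
by rewrite valK.
Qed.

Lemma extend_out n m (C : seq 'I_n) (T : bundles (size C) m) i :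
  i \notin C -> extend T i = set0.
Proof. by move=> iC; rewrite ffunE insubN // -leqNgt leqNgt index_mem. Qed.

Lemma extend_allocation n m (C : seq 'I_n) (T : bundles (size C) m) :
  uniq C -> is_allocation T -> is_allocation (extend T).
Proof.
move=> uC /forallP HT; apply/forallP => i; apply/forallP => j; apply/implyP => ij.
case: (boolP (i \in C)) => [iC|/extend_out->]; last by rewrite -setI_eq0 set0I.
case: (boolP (j \in C)) => [jC|/extend_out->]; last by rewrite -setI_eq0 setI0.
have [i' Hi] := tnthP (in_tuple C) i iC; have [j' Hj] := tnthP (in_tuple C) j jC.
rewrite Hi Hj !extend_tnth //.
have /forallP/(_ j')/implyP := HT i'; apply.
by apply: contraNneq ij => e; rewrite Hi Hj e.
Qed.

(** An arc that spoils an item joins two bidders who both hold items, hence two members of [C]. *)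
Lemma extend_useless n m (E : rel 'I_n) (EI : rel 'I_m) C
    (T : bundles (size C) m) i :
  independent E C -> useless E EI (extend T) i = set0.
Proof.
move=> iC; apply/setP => k; rewrite !inE; apply/negP => /andP[ki].
case/existsP=> j /existsP[l /and3P[lj Eij _]].
case: (boolP (i \in C)) ki => [Hi _|/extend_out->]; last by rewrite inE.
case: (boolP (j \in C)) lj => [Hj _|/extend_out->]; last by rewrite inE.
by move/negP: (iC i j Hi Hj).
Qed.

Lemma extend_welfare (R : realType) n m (E : rel 'I_n) (EI : rel 'I_m) C
    (T : bundles (size C) m) (v : profile R n m) :
  independent E C ->
  welfare (conflict_value E EI) v (extend T) =
  welfare (@plain_value R n m) v (extend T).
Proof.
by move=> iC; apply: eq_bigr => i _; rewrite /conflict_value extend_useless ?setD0.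
Qed.

(** A valuation need not vanish on the empty bundle. The bidders outside [C] add an amount
    independent of [T], so comparing choices of [T] gives the same answer in the sub-auction and in
    the whole auction. *)
Lemma extend_plain_welfare (R : realType) n m C
    (T : bundles (size C) m) (v : profile R n m) :
  uniq C ->
  welfare (@plain_value R n m) v (extend T) =
  welfare (@plain_value R _ m) (subprofile v C) T
    + \sum_(i | i \notin C) (v i set0)%:num.
Proof.
move=> uC; rewrite /welfare (bigID (mem C)) /=; congr (_ + _).
  rewrite -big_uniq //= big_tnth; apply: eq_bigr => j _.
  by rewrite /plain_value extend_tnth.
by apply: eq_bigr => i iC; rewrite /plain_value extend_out.
Qed.

Lemma best_spec (R : realType) n m (v : profile R n m) Ss :
  (0 < size Ss)%N ->
  best v Ss \in Ss /\
  forall S, S \in Ss ->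
    welfare (@plain_value R n m) v S
      <= welfare (@plain_value R n m) v (best v Ss).
Proof.
case: Ss => //= S0 Ss _; rewrite /best /=.
elim/last_ind: Ss => [|Ss S [IH1 IH2]] /=.
  by split; rewrite ?inE // => S; rewrite inE => /eqP ->.
rewrite foldl_rcons; move: IH1 IH2; set a := foldl _ _ _.
have : a <> None.
  by rewrite /a; elim: (Ss) (S0) => //= ? ? IH ?; case: ifP.
case: a => // A _ /= AS HA; case: ifPn => /= HS; split.
- by rewrite -rcons_cons mem_rcons mem_head.
- move=> S'; rewrite -rcons_cons mem_rcons inE => /predU1P[->//|/HA H].
  exact: le_trans H HS.
- by rewrite -rcons_cons mem_rcons inE AS orbT.
move=> S'; rewrite -rcons_cons mem_rcons inE => /predU1P[->|/HA//].
by apply: ltW; rewrite ltNge.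
Qed.

(** * Approximation ratio and incentives *)

Lemma le_max_welfare (R : realType) n m (val : value_fun R n m) v S :
  is_allocation S -> welfare val v S <= max_welfare val v.
Proof. by move=> HS; apply: (le_bigmax_cond _ (fun S => welfare val v S)). Qed.

Lemma max_welfare_le (R : realType) n m (val : value_fun R n m) v x :
  0 <= x -> (forall S, is_allocation S -> welfare val v S <= x) ->
  max_welfare val v <= x.
Proof. by move=> x0 H; apply: bigmax_le. Qed.

Lemma best_class_approx (R : realType) (F : plain_rule R) Delta
    (alpha : nat -> R) n m (E : rel 'I_n) (EI : rel 'I_m) :
  (1 <= Delta)%N -> (forall m, 1 <= alpha m) ->
  (forall n m, approximates (@plain_value R n m) (alpha m) (F n m)) ->
  bidder_graph Delta E ->
  approximates (conflict_value E EI)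
    (16%:R * Delta%:R * alpha m / 3%:R) (best_class_rule F Delta E EI).
Proof.
move=> hD ha hF HE v; have [sC pC iC uC] := classesP HE.
set Ss := [seq class_bundles F v C | C <- classes E Delta].
have sS : (0 < size Ss)%N by rewrite size_map sC.
have [HS Hmax] := best_spec v sS.
have /mapP[C HC eC] := HS.
have FA k w : is_allocation (F k m w) by case: (hF k m w).
rewrite /best_class_rule -/Ss; split.
  by rewrite eC; apply: extend_allocation; [exact: uC|exact: FA].
set W := welfare _ v _.
have eW : W = welfare (@plain_value R n m) v (best v Ss).
  by rewrite /W eC; apply: extend_welfare; exact: iC.
have a0 : 0 < alpha m by apply: lt_le_trans (ha m).
have D1 : 1 <= Delta%:R :> R by rewrite ler1n.
have W0 : 0 <= W by apply: sumr_ge0 => i _; rewrite /conflict_value.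
have aW0 : 0 <= alpha m * W by apply: mulr_ge0 => //; exact: ltW.
have c0 : 0 < 16%:R * Delta%:R * alpha m / 3%:R.
  by rewrite divr_gt0 // !mulr_gt0 // ltr0n.
rewrite mulrC ler_pdivrMr // [leRHS]mulrC.
have -> : 16%:R * Delta%:R * alpha m / 3%:R * W =
          16%:R * Delta%:R / 3%:R * (alpha m * W) by field.
suff H : max_welfare (conflict_value E EI) v <= Delta.*2.+1%:R * (alpha m * W).
  apply: le_trans H _; apply: ler_wpM2r => //.
  (* This amounts to [1 <= 10 Delta / 3], which follows from [Delta >= 1]. *)
  rewrite -addn1 -muln2 natrD natrM; lra.
apply: max_welfare_le => [|S /forallP SA]; first exact: mulr_ge0.
(* The welfare of [S] splits into sums over the classes and the right-hand side into one copy of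
   [alpha m * W] per class; the two are compared class by class. *)
rewrite /welfare -big_enum -(perm_big _ pC) big_flatten /= -sC.
rewrite mulr_natl -[X in _ *+ X]count_predT -[leRHS]addr0 -iter_addr.
rewrite -big_const_seq !big_seq; apply: ler_sum => D HD.
have uD := uC D HD.
(* Valuations need not be monotone, so the useless items are removed: the sub-auction must see
   exactly the bundle that [conflict_value] evaluates. *)
pose T : bundles (size D) m :=
  [ffun j => S (tnth (in_tuple D) j) :\: useless E EI S (tnth (in_tuple D) j)].
have TA : is_allocation T.
  apply/forallP => i; apply/forallP => j; apply/implyP => ij; rewrite !ffunE.
  have nij : tnth (in_tuple D) i != tnth (in_tuple D) j.
    by apply: contra ij => /eqP/(tuple_uniqP (in_tuple D) uD) ->.
  have /forallP/(_ (tnth (in_tuple D) j))/implyP/(_ nij) :=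
    SA (tnth (in_tuple D) i).
  by move=> dS; apply: disjointW dS; apply: subsetDl.
have -> : \sum_(i <- D) conflict_value E EI i (v i) S =
    welfare (@plain_value R _ m) (subprofile v D) T.
  rewrite big_tnth; apply: eq_bigr => j _.
  by rewrite /conflict_value /plain_value ffunE.
apply: le_trans (le_max_welfare _ _ TA) _.
have [_] := hF _ m (subprofile v D).
rewrite mulrC ler_pdivrMr // mulrC => /le_trans; apply.
apply: ler_wpM2l; first exact: ltW.
have : class_bundles F v D \in Ss by apply: map_f.
move/Hmax; rewrite -eW /class_bundles extend_plain_welfare //; apply: le_trans.
by rewrite lerDl; apply: sumr_ge0.
Qed.

(** The witness is the image of the rule. A point of it extends an output of [F] on some class [C];
    maximality of [F] on [C] bounds it by the candidate that [F] now yields on [C], and the best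
    candidate bounds that one. *)
Lemma best_class_maximal (R : realType) (F : plain_rule R) Delta
    n m (E : rel 'I_n) (EI : rel 'I_m) :
  (forall n m, maximal_in_range (@plain_value R n m) (F n m)) ->
  bidder_graph Delta E ->
  maximal_in_range (conflict_value E EI) (best_class_rule F Delta E EI).
Proof.
move=> hM HE; have [sC pC iC uC] := classesP HE.
set G := best_class_rule F Delta E EI.
have G_class v : exists2 C, C \in classes E Delta & G v = class_bundles F v C.
  have [|+ _] := @best_spec R n m v [seq class_bundles F v C | C <- classes E Delta].
    by rewrite size_map sC.
  by case/mapP => C; exists C.
exists [set S | `[< exists v, G v = S >]]; split.
  move=> S; rewrite inE => /asboolP[v <-]; have [C HC ->] := G_class v.
  apply: extend_allocation; first exact: uC.
  have [A' [HA HF]] := hM (size C) m.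
  by apply: HA; case: (HF (subprofile v C)).
move=> v; split=> [|S]; first by rewrite inE; apply/asboolP; exists v.
rewrite inE => /asboolP[w <-].
have [C HC ->] := G_class w; have [D HD eD] := G_class v.
rewrite eD !extend_welfare -/(class_bundles F v D) -?eD;
  [|exact: iC..].
have [|_ /(_ (class_bundles F v C))] :=
    @best_spec R n m v [seq class_bundles F v C | C <- classes E Delta].
  by rewrite size_map sC.
move=> /(_ (map_f _ HC)); rewrite -/(best_class_rule F Delta E EI v) -/G.
apply: le_trans; rewrite !extend_plain_welfare ?uC // lerD2r.
have [A' [_ HF]] := hM (size C) m.
have [_ /(_ (F (size C) m (subprofile w C)))] := HF (subprofile v C); apply.
by case: (HF (subprofile w C)).
Qed.

(* VCG: charging each bidder minus the welfare of the others makes the utility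
   of a bidder equal to the welfare of the chosen allocation. *)
Lemma maximal_in_range_truthful (R : realType) n m (val : value_fun R n m) F :
  maximal_in_range val F -> truthful val F.
Proof.
move=> [A' [_ HF]].
exists (fun i v => - \sum_(j | j != i) val j (v j) (F v)) => i v w.
rewrite !opprK.
have -> : \sum_(j | j != i) val j (report v i w j) (F (report v i w)) =
          \sum_(j | j != i) val j (v j) (F (report v i w)).
  by apply: eq_bigr => j /negbTE ji; rewrite /report ji.
have [Hr _] := HF (report v i w); have [_ /(_ _ Hr)] := HF v.
by rewrite /welfare (bigD1 i) // [leRHS](bigD1 i).
Qed.

(** * Register programs *)

Definition agree (R : Type) (k : nat) (s s' : store R) : Prop :=
  forall y, (y < k)%N -> s' y = s y.

(* Registers below [k] are live; those from [k] on are scratch space of [c]. *)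
Definition comp (R : realType) n (ask : 'I_n -> data R -> data R) (k : nat)
    (c : cmd) (s : store R) (b : nat) (d : data R) : Prop :=
  exists s' t, [/\ exec ask c s s' t, (t <= b)%N, s' k = d & agree k s s'].

(** [c2] finds the value of [c1] in [k] and works one register higher; its result is then copied
    down. *)
Definition let_cmd (k : nat) (c1 c2 : cmd) : cmd :=
  Seq c1 (Seq c2 (Assign k (Var k.+1))).

(** Register [k] holds the accumulator, [k.+1] the rest of the list, [k.+2] the current element;
    [body] leaves the new accumulator in [k.+3]. *)
Definition fold_cmd (k : nat) (el ei : expr) (body : cmd) : cmd :=
  Seq (Assign k.+1 el) (Seq (Assign k ei)
    (While (Var k.+1)
      (Seq (Assign k.+2 (EFst (Var k.+1))) (Seq (Assign k.+1 (ESnd (Var k.+1)))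
        (Seq body (Assign k (Var k.+3))))))).

Lemma set_var_eq (R : Type) (s : store R) x d : set_var s x d x = d.
Proof. by rewrite /set_var eqxx. Qed.

Lemma set_var_neq (R : Type) (s : store R) x y d :
  y != x -> set_var s x d y = s y.
Proof. by rewrite /set_var => /negbTE ->. Qed.

Lemma agree_trans (R : Type) k (s1 s2 s3 : store R) :
  agree k s1 s2 -> agree k s2 s3 -> agree k s1 s3.
Proof. by move=> H1 H2 y yk; rewrite H2 ?H1. Qed.

Lemma agreeW (R : Type) k k' (s s' : store R) :
  (k <= k')%N -> agree k' s s' -> agree k s s'.
Proof. by move=> kk H y yk; apply: H; apply: leq_trans kk. Qed.

Lemma agree_set (R : Type) k x d (s s' : store R) :
  (k <= x)%N -> agree k s s' -> agree k s (set_var s' x d).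
Proof.
by move=> kx H y yk; rewrite set_var_neq ?H //; apply: contraTneq yk => ->; lia.
Qed.

Section Machine.
Variables (R : realType) (n : nat) (ask : 'I_n -> data R -> data R).
Implicit Types (s : store R) (d : data R).

Lemma compW k c s b b' d :
  (b <= b')%N -> comp ask k c s b d -> comp ask k c s b' d.
Proof. by move=> bb [s' [t [? ? ? ?]]]; exists s', t; split=> //; lia. Qed.

Lemma comp_assign k e s d : eval s e = d -> comp ask k (Assign k e) s 1 d.
Proof.
move=> <-; exists (set_var s k (eval s e)), 1%N; split=> //.
- exact: exec_assign.
- exact: set_var_eq.
- exact: agree_set.
Qed.

Lemma comp_let k c1 c2 s b1 b2 d1 d2 :
  comp ask k c1 s b1 d1 ->
  (forall s', agree k s s' -> s' k = d1 -> comp ask k.+1 c2 s' b2 d2) ->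
  comp ask k (let_cmd k c1 c2) s (b1 + b2 + 1) d2.
Proof.
move=> [s1 [t1 [x1 l1 v1 a1]]] /(_ s1 a1 v1) [s2 [t2 [x2 l2 v2 a2]]].
exists (set_var s2 k (s2 k.+1)), (t1 + (t2 + 1))%N; split.
- apply: exec_seq x1 _; apply: exec_seq x2 _; exact: exec_assign.
- lia.
- by rewrite set_var_eq.
- by apply: agree_set => //; apply: agree_trans a1 _; apply: agreeW a2.
Qed.

Lemma comp_if k e c1 c2 s b d :
  (truthy (eval s e) -> comp ask k c1 s b d) ->
  (~~ truthy (eval s e) -> comp ask k c2 s b d) ->
  comp ask k (If e c1 c2) s b.+1 d.
Proof.
case: (boolP (truthy _)) => He H1 H2.
  have [s' [t [x l v a]]] := H1 isT; exists s', t.+1; split=> //.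
  exact: exec_if_true.
have [s' [t [x l v a]]] := H2 isT; exists s', t.+1; split=> //.
exact: exec_if_false.
Qed.

Lemma comp_query k e1 e2 s (i : 'I_n) d :
  eval s e1 = code_nat R i -> ask i (eval s e2) = d ->
  comp ask k (Query k e1 e2) s 1 d.
Proof.
move=> He <-; exists (set_var s k (ask i (eval s e2))), 1%N; split=> //.
- exact: exec_query.
- exact: set_var_eq.
- exact: agree_set.
Qed.

(** The invariant [P] also sees the elements to come, so it can relate the accumulator to the rounds
    left. Beyond the body, a round spends four steps: the test, two assignments that unpack the
    list, and the copy. The extra three are the initial assignments and the last test. *)
Lemma comp_fold (A X : Type) (ca : A -> data R) (cx : X -> data R)
    (step : A -> X -> A) (P : seq X -> A -> Prop) k el ei body s b xs a0 :
  eval s el = code_list (map cx xs) ->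
  (forall s', agree k s s' -> eval s' ei = ca a0) ->
  P xs a0 ->
  (forall x r a s', P (x :: r) a -> agree k s s' -> s' k = ca a ->
     s' k.+2 = cx x ->
     comp ask k.+3 body s' b (ca (step a x)) /\ P r (step a x)) ->
  comp ask k (fold_cmd k el ei body) s (size xs * (b + 4) + 3)
    (ca (foldl step a0 xs)).
Proof.
move=> Hl Hi HP Hb.
rewrite /fold_cmd; set w := While _ _.
suff H : forall xs a s1, P xs a -> agree k s s1 -> s1 k = ca a ->
    s1 k.+1 = code_list (map cx xs) ->
    exists s' t, [/\ exec ask w s1 s' t, (t <= size xs * (b + 4) + 1)%N,
      s' k = ca (foldl step a xs) & agree k s s'].
  pose s0 := set_var s k.+1 (eval s el).
  have A0 : agree k s s0 by apply: agree_set.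
  have [||||s' [t [x l v a]]] := H xs a0 (set_var s0 k (eval s0 ei)) => //.
  - exact: agree_set.
  - by rewrite set_var_eq Hi.
  - by rewrite set_var_neq; [rewrite /s0 set_var_eq|lia].
  exists s', (1 + (1 + t))%N; split=> //; last lia.
  apply: exec_seq; first exact: exec_assign.
  by apply: exec_seq x; apply: exec_assign.
elim=> [|x r IH] a s1 HPa A1 v1 l1.
  by exists s1, 1%N; split=> //; apply: exec_while_false; rewrite /= l1.
pose s2 := set_var s1 k.+2 (cx x).
pose s3 := set_var s2 k.+1 (code_list (map cx r)).
have [|||[s4 [t4 [x4 b4 v4 A4]]] HPr] := Hb x r a s3 HPa.
- by do 2 (apply: agree_set; first lia).
- by rewrite /s3 /s2 !set_var_neq //; lia.
- by rewrite /s3 /s2 set_var_neq ?set_var_eq //; lia.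
have A14 : agree k s (set_var s4 k (s4 k.+3)).
  apply: agree_set => //; apply: agree_trans (agreeW _ A4); last lia.
  by do 2 (apply: agree_set; first lia).
have [|| s' [t' [x' b' v' A']]] := IH _ (set_var s4 k (s4 k.+3)) HPr A14.
- by rewrite set_var_eq v4.
- rewrite set_var_neq; last lia.
  by rewrite A4 /s3 ?set_var_eq //; lia.
exists s', ((1 + (1 + (t4 + 1))) + t').+1; split=> //; last by rewrite /=; lia.
apply: exec_while_true x'; first by rewrite /= l1.
apply: exec_seq; first by apply: exec_assign.
rewrite /= l1 /= -/s2; apply: exec_seq; first exact: exec_assign.
have -> : eval s2 (ESnd (Var k.+1)) = code_list (map cx r).
  by rewrite /= /s2 set_var_neq ?l1 //; lia.
by rewrite -/s3; apply: exec_seq x4 _; apply: exec_assign.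
Qed.

(** A unary number is a list of empty trees, so folding over it repeats a body that many times. *)
Lemma code_nat_list j : code_nat R j = code_list (map (fun=> Nil) (nseq j tt)).
Proof. by elim: j => //= j ->. Qed.

Definition drop_cmd k el ei := fold_cmd k el ei (Assign k.+3 (ESnd (Var k))).

Lemma comp_drop k s el ei j (l : seq (data R)) :
  eval s el = code_nat R j ->
  (forall s', agree k s s' -> eval s' ei = code_list l) ->
  comp ask k (drop_cmd k el ei) s (j * 5 + 3) (code_list (drop j l)).
Proof.
move=> Hl Hi.
have -> : drop j l = foldl (fun l (_ : unit) => behead l) l (nseq j tt).
  by elim: j l {Hl Hi} => [|j IH] l /=; rewrite ?drop0 // -IH -drop1 drop_drop addn1.
have := @comp_fold (seq (data R)) unit (@code_list R) (fun=> Nil)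
  (fun l _ => behead l) (fun _ _ => True) k el ei _ s 1 (nseq j tt) l.
rewrite size_nseq; apply=> //; first by rewrite Hl code_nat_list.
move=> x r a s' _ _ va _; split=> //; apply: comp_assign.
by rewrite /= va; case: (a).
Qed.

End Machine.

(** * Computing the colouring *)

(* A vertex of the bidder graph is represented by its index in unary (for
   queries), its index as a number (for comparisons) and its adjacency row. *)
Definition code_vertex (R : realType) n (E : rel 'I_n) (i : 'I_n) : data R :=
  Pair (code_nat R i) (Pair (Num i%:R) (code_set R [set j | E i j])).

Definition code_vertices (R : realType) n (E : rel 'I_n) (C : seq 'I_n) :=
  code_list (map (@code_vertex R n E) C).

Definition code_classes (R : realType) n (E : rel 'I_n) (Cs : seq (seq 'I_n)) :=
  code_list (map (@code_vertices R n E) Cs).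

Definition idx e := EFst e.
Definition num e := EFst (ESnd e).
Definition row e := ESnd (ESnd e).
Definition incr e := EAdd e EOne.
Definition numeral k := iter k incr EZero.

Lemma eval_numeral (R : realType) (s : store R) k :
  eval s (numeral k) = Num k%:R.
Proof. by elim: k => //= k ->; rewrite -natr1. Qed.

Lemma code_set_nth (R : realType) n (A : {set 'I_n}) (j : 'I_n) :
  exists l, drop j [seq code_bool R (k \in A) | k <- enum 'I_n] =
    code_bool R (j \in A) :: l.
Proof.
pose f k := code_bool R (k \in A); exists (drop j.+1 (map f (enum 'I_n))).
have jn : (j < size (enum 'I_n))%N by rewrite size_enum_ord.
rewrite (drop_nth (f j)); last by rewrite size_map.
by rewrite (nth_map j) // nth_ord_enum.
Qed.

Lemma truthy_code_bool (R : realType) b : truthy (code_bool R b) = b.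
Proof. by case: b. Qed.

Definition hits_cmd k v C :=
  fold_cmd k (Var C) EZero
   (let_cmd k.+3 (drop_cmd k.+3 (idx (Var k.+2)) (row (Var v)))
   (let_cmd k.+4 (drop_cmd k.+4 (idx (Var v)) (row (Var k.+2)))
     (If (EFst (Var k.+3))
       (If (EFst (Var k.+4)) (Assign k.+4.+1 (incr (incr (Var k))))
                             (Assign k.+4.+1 (incr (Var k))))
       (If (EFst (Var k.+4)) (Assign k.+4.+1 (incr (Var k)))
                             (Assign k.+4.+1 (Var k)))))).

Definition search_cmd k d C :=
  fold_cmd k (Var C) (EPair ENil ENil)
   (If (EFst (Var k))
     (Assign k.+3 (EPair (EFst (Var k)) (EPair (Var k.+2) (ESnd (Var k)))))
     (let_cmd k.+3 (hits_cmd k.+3 k.+2 C)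
       (If (ELe (Var k.+3) (numeral d))
         (Assign k.+4 (EPair (Var k.+2) (ESnd (Var k))))
         (Assign k.+4 (EPair ENil (EPair (Var k.+2) (ESnd (Var k)))))))).

(** The result of the search is pushed without a test. This agrees with [peel_step] because the
    search always succeeds under [peel_inv]. *)
Definition peel_cmd k d V :=
  fold_cmd k (Var V) (EPair (Var V) ENil)
   (let_cmd k.+3 (Assign k.+3 (EFst (Var k)))
   (let_cmd k.+4 (search_cmd k.+4 d k.+3)
     (Assign k.+4.+1 (EPair (ESnd (Var k.+4))
                         (EPair (EFst (Var k.+4)) (ESnd (Var k))))))).

Definition place_cmd k v Cs :=
  fold_cmd k (Var Cs) (EPair (EPair ENil ENil) ENil)
   (If (EFst (Var k))
     (let_cmd k.+3 (hits_cmd k.+3 v k.+2)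
       (If (ELe (Var k.+3) EZero)
         (Assign k.+4 (EPair ENil
           (EPair (EPair (Var v) (Var k.+2)) (ESnd (Var k)))))
         (Assign k.+4 (EPair (EPair ENil ENil)
           (EPair (Var k.+2) (ESnd (Var k)))))))
     (Assign k.+3 (EPair ENil (EPair (Var k.+2) (ESnd (Var k)))))).

Definition colour_cmd k d V :=
  let_cmd k (let_cmd k (peel_cmd k d V) (Assign k.+1 (ESnd (Var k))))
   (fold_cmd k.+1 (Var k) (iter d.+1 (EPair ENil) ENil)
     (let_cmd k.+4 (place_cmd k.+4 k.+3 k.+1) (Assign k.+4.+1 (ESnd (Var k.+4))))).

Definition hits_cost n := (n * (10 * n + 15) + 3)%N.
Definition search_cost n := (n * (hits_cost n + 8) + 3)%N.
Definition peel_cost n := (n * (search_cost n + 8) + 3)%N.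
Definition place_cost n d := (d.+1 * (hits_cost n + 8) + 3)%N.
Definition colour_cost n d :=
  (peel_cost n + n * (place_cost n d + 8) + 8)%N.

Section Colouring.
Variables (R : realType) (n : nat) (ask : 'I_n -> data R -> data R).
Variable E : rel 'I_n.
Implicit Types (s : store R) (d : data R) (C : seq 'I_n).

Local Notation cv := (@code_vertex R n E).
Local Notation cl := (@code_vertices R n E).
Local Notation comp := (comp ask).

Lemma comp_hits k s x y v C :
  (x < k)%N -> (y < k)%N -> s x = cv v -> s y = cl C -> (size C <= n)%N ->
  comp k (hits_cmd k x y) s (hits_cost n) (Num (hits E v C)%:R).
Proof.
move=> xk yk sx sy sC.
have -> : hits E v C = foldl (fun a u => a + E v u + E u v)%N 0%N C.
  rewrite /hits; elim/last_ind: C {sy sC} => [|C u IH]; first by rewrite big_nil.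
  by rewrite big_rcons foldl_rcons /= IH; lia.
apply: (@compW _ _ _ _ _ _ (size C * (10 * n + 11 + 4) + 3)).
  by rewrite /hits_cost; nia.
apply: (@comp_fold _ _ _ _ _ (fun a : nat => Num a%:R) cv _ (fun _ _ => True))
  => // u r a s' _ A va vu; split=> //.
have s'x : s' x = cv v by rewrite A.
apply: (@compW _ _ _ _ _ _ (5 * n + 3 + (5 * n + 3 + 3 + 1) + 1)); first by lia.
have [l1 e1] := code_set_nth R [set j | E v j] u.
have [l2 e2] := code_set_nth R [set j | E u j] v.
apply: comp_let.
  apply: compW; last first.
    apply: (@comp_drop _ _ _ _ _ _ _ u
      [seq code_bool R (k \in [set j | E v j]) | k <- enum 'I_n]).
      by rewrite /= vu.
    by move=> s1 A1; rewrite /= A1 ?s'x //; lia.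
  by have := ltn_ord u; lia.
rewrite e1 => s1 A1 v1; apply: comp_let.
  apply: compW; last first.
    apply: (@comp_drop _ _ _ _ _ _ _ v
      [seq code_bool R (k \in [set j | E u j]) | k <- enum 'I_n]).
      by rewrite /= A1 ?s'x //; lia.
    by move=> s2 A2; rewrite /= A2 ?A1 ?vu //; lia.
  by have := ltn_ord v; lia.
rewrite e2 => s2 A2 v2.
have s2k : s2 k = Num a%:R by rewrite A2 ?A1 ?va //; lia.
have s2k3 : eval s2 (EFst (Var k.+3)) = code_bool R (E v u).
  by rewrite /= A2 ?v1 /= ?inE //; lia.
have s2k4 : eval s2 (EFst (Var k.+4)) = code_bool R (E u v).
  by rewrite /= v2 /= inE.
apply: comp_if; rewrite s2k3 truthy_code_bool => Evu;
  apply: comp_if; rewrite s2k4 truthy_code_bool => Euv; apply: comp_assign;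
  by rewrite /= s2k /= ?Evu ?Euv ?(negbTE Evu) ?(negbTE Euv) ?addn1 ?addn0 -?natr1.
Qed.

(** A vertex is coded by a pair, so truth of the first component distinguishes it from [None]. *)
Definition code_search (a : option 'I_n * seq 'I_n) : data R :=
  Pair (if a.1 is Some v then cv v else Nil) (cl a.2).

Lemma comp_search k s e y C :
  (y < k)%N -> s y = cl C -> (size C <= n)%N ->
  comp k (search_cmd k e y) s (search_cost n) (code_search (search E e C)).
Proof.
move=> yk sy sC.
apply: (@compW _ _ _ _ _ _ (size C * (hits_cost n + 4 + 4) + 3)).
  by rewrite /search_cost -addnA leq_add2r leq_mul2r ?sC ?sV orbT.
apply: (@comp_fold _ _ _ _ _ code_search cv _ (fun _ _ => True))
  => // u r [o l] s' _ A va vu; split=> //.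
rewrite addn4; apply: comp_if; rewrite /= va /= /search_step /=.
  case: o va => //= w va _; apply: (@compW _ _ _ _ _ _ 1) => //.
  by apply: comp_assign; rewrite /= va vu.
case: o va => //= va _.
apply: (@compW _ _ _ _ _ _ (hits_cost n + 2 + 1)); first by lia.
apply: comp_let.
  by apply: (@comp_hits _ _ _ _ u C) => //; [lia|rewrite A].
move=> s1 A1 v1.
have e1 : s1 k = s' k by rewrite A1 //; lia.
have e2 : s1 k.+2 = s' k.+2 by rewrite A1 //; lia.
apply: comp_if; rewrite /= eval_numeral v1 /= ler_nat truthy_code_bool => H;
  apply: comp_assign; rewrite /= e1 e2 va vu ?H ?(negbTE H) //.
Qed.

Definition code_peel (a : seq 'I_n * seq 'I_n) : data R := Pair (cl a.1) (cl a.2).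

Lemma comp_peel k s Delta x V :
  bidder_graph Delta E -> uniq V -> (size V <= n)%N -> (x < k)%N -> s x = cl V ->
  comp k (let_cmd k (peel_cmd k Delta.*2 x) (Assign k.+1 (ESnd (Var k)))) s
    (peel_cost n + 2) (cl (peel E Delta.*2 V)).
Proof.
move=> HE uV sV xk sx.
rewrite -[2%N]/(1 + 1)%N addnA.
set a := foldl (peel_step E Delta.*2) (V, [::]) V.
apply: (@comp_let _ _ _ _ _ _ _ _ _ (code_peel a)); last first.
  by move=> s1 A1 v1; apply: comp_assign; rewrite /= v1.
apply: (@compW _ _ _ _ _ _ (size V * (search_cost n + 4 + 4) + 3)).
  by rewrite /peel_cost -addnA leq_add2r leq_mul2r ?sC ?sV orbT.
apply: (@comp_fold _ _ _ _ _ code_peel cv _ (peel_inv E Delta.*2 V)) => //.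
- by move=> s' A; rewrite /= A ?sx.
- by rewrite /peel_inv /= eqxx cats0 perm_refl.
move=> u r b s' Hb A va vu.
have [w [R' [Hs HR]]] := peel_inv_step HE uV Hb.
rewrite {1 2}/peel_step Hs /=; split=> //.
apply: (@compW _ _ _ _ _ _ (1 + (search_cost n + 1 + 1) + 1)); first by lia.
apply: comp_let; first by apply: comp_assign; rewrite /= va.
move=> s1 A1 v1; apply: comp_let.
  apply: (@comp_search _ _ _ _ b.1) => //.
  have /and3P[_ _ /perm_size pb] := Hb.
  by apply: leq_trans sV; rewrite -pb size_cat leq_addr.
move=> s2 A2 v2; apply: comp_assign.
have -> : eval s2 (EPair (ESnd (Var k.+4)) (EPair (EFst (Var k.+4)) (ESnd (Var k))))
   = Pair (cl R') (Pair (cv w) (cl b.2)) => //.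
by rewrite /= v2 A2 ?A1 ?va ?Hs //=; lia.
Qed.

Definition code_place (a : bool * seq (seq 'I_n)) : data R :=
  Pair (code_bool R a.1) (code_classes R E a.2).

Lemma comp_place k s x y v Cs :
  (x < k)%N -> (y < k)%N -> s x = cv v -> s y = code_classes R E Cs ->
  all (fun C => size C <= n)%N Cs ->
  comp k (place_cmd k x y) s (place_cost n (size Cs).-1)
    (code_place (foldl (place_step E v) (true, [::]) Cs)).
Proof.
move=> xk yk sx sy sC.
apply: (@compW _ _ _ _ _ _ (size Cs * (hits_cost n + 4 + 4) + 3)).
  by rewrite /place_cost; case: (Cs) => //= *; lia.
apply: (@comp_fold _ _ _ _ _ code_place cl _
  (fun r _ => all (fun C => size C <= n)%N r)) => //.
move=> C r [p D] s' /= /andP[HC Hr] A va vC; split=> //.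
rewrite addn4; apply: comp_if; rewrite /= va truthy_code_bool /place_step /= => Hp;
  last first.
  rewrite (negbTE Hp); apply: (@compW _ _ _ _ _ _ 1) => //.
  by apply: comp_assign; rewrite /= va vC.
rewrite Hp; apply: (@compW _ _ _ _ _ _ (hits_cost n + 2 + 1)); first by lia.
apply: comp_let.
  by apply: (@comp_hits _ _ _ _ v C) => //; [lia|rewrite A].
move=> s1 A1 v1.
have e1 : s1 k = s' k by rewrite A1 //; lia.
have e2 : s1 k.+2 = s' k.+2 by rewrite A1 //; lia.
have e3 : s1 x = cv v by rewrite A1 ?A //; lia.
apply: comp_if; rewrite /= v1 /= lern0 truthy_code_bool => H;
  apply: comp_assign; rewrite /= e1 e2 ?e3 va vC ?H ?(negbTE H) //.
Qed.

Lemma eval_empties s j : eval s (iter j (EPair ENil) ENil) =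
  code_classes R E (nseq j [::]).
Proof. by elim: j => //= j ->. Qed.

Lemma comp_colour k s Delta x V :
  bidder_graph Delta E -> uniq V -> (size V <= n)%N -> (x < k)%N -> s x = cl V ->
  comp k (colour_cmd k Delta.*2 x) s (colour_cost n Delta.*2)
    (code_classes R E (colour E Delta.*2 V)).
Proof.
move=> HE uV sV xk sx; have [sp pV] := peel_spec HE uV.
have sP : (size (peel E Delta.*2 V) <= n)%N by rewrite (perm_size pV).
apply: (@compW _ _ _ _ _ _ (peel_cost n + 2 +
    (size (peel E Delta.*2 V) * (place_cost n Delta.*2 + 1 + 1 + 4) + 3) + 1)).
  have : (size (peel E Delta.*2 V) * (place_cost n Delta.*2 + 8)
    <= n * (place_cost n Delta.*2 + 8))%N by rewrite leq_mul2r sP orbT.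
  by rewrite /colour_cost; lia.
apply: comp_let; first exact: (comp_peel HE uV sV xk sx).
move=> s1 A1 v1.
(* The invariant keeps every class within [n] bidders and their number at [Delta.*2.+1], as the cost
   of [comp_place] requires. *)
apply: (@comp_fold _ _ _ _ _ (code_classes R E) cv _ (fun r Cs => exists2 D,
  colouring E Delta.*2 D Cs & sparse E Delta.*2 D r /\ (size D + size r <= n)%N)) => //.
- by move=> s' _; rewrite eval_empties.
- exists [::]; last by split.
  split; first by rewrite size_nseq.
    by elim: (Delta.*2.+1).
  by move=> C; rewrite mem_nseq => /eqP ->.
move=> u r Cs s' [D HD [/= /andP[Hu Hr] Hs]] A va vu; split; last first.
  exists (u :: D); first by apply: place_colouring => //; case: HE.
  by split=> //=; lia.
apply: (@comp_let _ _ _ _ _ _ _ _ _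
  (code_place (foldl (place_step E u) (true, [::]) Cs))); last first.
  by move=> s2 A2 v2; apply: comp_assign; rewrite /= v2.
case: HD => sC pC _.
have -> : Delta.*2 = (size Cs).-1 by rewrite sC.
apply: comp_place => //; first by lia.
apply/allP => C CC; have : (size C <= size (flatten Cs))%N.
  elim: (Cs) CC => //= C' Cs' IH; rewrite inE size_cat => /predU1P[->|/IH]; lia.
move/leq_trans; apply; rewrite (perm_size pC); exact: leq_trans (leq_addr _ _) Hs.
Qed.

End Colouring.

(** * Running the given program on a class *)

Fixpoint shift_expr (o : nat) (e : expr) : expr :=
  match e with
  | Var x => Var (o + x)
  | ENil => ENil
  | EPair e1 e2 => EPair (shift_expr o e1) (shift_expr o e2)
  | EFst e1 => EFst (shift_expr o e1)
  | ESnd e1 => ESnd (shift_expr o e1)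
  | EIsNum e1 => EIsNum (shift_expr o e1)
  | EZero => EZero
  | EOne => EOne
  | EAdd e1 e2 => EAdd (shift_expr o e1) (shift_expr o e2)
  | ESub e1 e2 => ESub (shift_expr o e1) (shift_expr o e2)
  | EMul e1 e2 => EMul (shift_expr o e1) (shift_expr o e2)
  | EDiv e1 e2 => EDiv (shift_expr o e1) (shift_expr o e2)
  | ELe e1 e2 => ELe (shift_expr o e1) (shift_expr o e2)
  end.

Fixpoint expr_bound (e : expr) : nat :=
  match e with
  | Var x => x.+1
  | ENil | EZero | EOne => 0
  | EFst e1 | ESnd e1 | EIsNum e1 => expr_bound e1
  | EPair e1 e2 | EAdd e1 e2 | ESub e1 e2 | EMul e1 e2 | EDiv e1 e2
  | ELe e1 e2 => maxn (expr_bound e1) (expr_bound e2)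
  end.

Fixpoint cmd_bound (c : cmd) : nat :=
  match c with
  | Skip => 0
  | Assign x e => maxn x.+1 (expr_bound e)
  | Query x e1 e2 => maxn x.+1 (maxn (expr_bound e1) (expr_bound e2))
  | Seq c1 c2 => maxn (cmd_bound c1) (cmd_bound c2)
  | If e c1 c2 => maxn (expr_bound e) (maxn (cmd_bound c1) (cmd_bound c2))
  | While e c1 => maxn (expr_bound e) (cmd_bound c1)
  end.

(* [redirect k L c] is [c] with its variables moved to [k.+2] and above and with
   the bidder [j] of a query replaced by the [j]-th vertex of the list [L]. *)
Fixpoint redirect (k L : nat) (c : cmd) : cmd :=
  match c with
  | Skip => Skip
  | Assign x e => Assign (k.+2 + x) (shift_expr k.+2 e)
  | Query x e1 e2 =>
      Seq (Assign k (shift_expr k.+2 e1)) (Seq (Assign k.+1 (Var L))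
        (Seq (While (Var k) (Seq (Assign k (ESnd (Var k)))
                                 (Assign k.+1 (ESnd (Var k.+1)))))
          (Query (k.+2 + x) (idx (EFst (Var k.+1))) (shift_expr k.+2 e2))))
  | Seq c1 c2 => Seq (redirect k L c1) (redirect k L c2)
  | If e c1 c2 => If (shift_expr k.+2 e) (redirect k L c1) (redirect k L c2)
  | While e c1 => While (shift_expr k.+2 e) (redirect k L c1)
  end.

Definition shifted (R : Type) o B (s S : store R) : Prop :=
  forall x, (x < B)%N -> S (o + x)%N = s x.

Lemma eval_shift (R : realType) o B (s S : store R) e :
  shifted o B s S -> (expr_bound e <= B)%N ->
  eval S (shift_expr o e) = eval s e.
Proof.
move=> H; elim: e => //=;
  by [move=> x; apply: H | move=> e IH /IH ->
     | move=> e1 IH1 e2 IH2; rewrite geq_max => /andP[/IH1-> /IH2->]].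
Qed.

Lemma shifted_set (R : Type) o B (s S : store R) x d :
  shifted o B s S -> shifted o B (set_var s x d) (set_var S (o + x) d).
Proof. by move=> H y yB; rewrite /set_var eqn_add2l H. Qed.

(** A program starts with all registers but 0 empty, whereas the area where it is simulated may hold
    leftovers of earlier computations. *)
Fixpoint reset (o B : nat) : cmd :=
  if B is B'.+1 then Seq (reset o B') (Assign (o + B') ENil) else Skip.

Definition len_cmd k L := fold_cmd k (Var L) ENil (Assign k.+3 (EPair ENil (Var k))).

(** [redirect k.+1] sends register 0 of [f] to [k.+3], which therefore receives the input and
    delivers the output. The successor in [(cmd_bound f).+1] keeps that register in range even if
    [f] mentions none. *)
Definition call_cmd k L M f :=
  let_cmd k (len_cmd k L)
   (Seq (reset k.+3 (cmd_bound f).+1)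
   (Seq (Assign k.+3 (EPair (Var k) (Var M)))
   (Seq (redirect k.+1 L f) (Assign k.+1 (Var k.+3))))).

(** The class and its bundles are walked in parallel. Indices are compared as numbers, so equality
    takes two tests. *)
Definition lookup_cmd k V M L T :=
  fold_cmd k (Var L) (EPair (Var T) (Var M))
   (If (ELe (num (Var k.+2)) (num (Var V)))
     (If (ELe (num (Var V)) (num (Var k.+2)))
       (Assign k.+3 (EPair (ESnd (EFst (Var k))) (EFst (EFst (Var k)))))
       (Assign k.+3 (EPair (ESnd (EFst (Var k))) (ESnd (Var k)))))
     (Assign k.+3 (EPair (ESnd (EFst (Var k))) (ESnd (Var k))))).

(** One pass yields both the welfare and the bundles; visiting the vertices backwards leaves the
    bundles in increasing order of bidders. *)
Definition extend_cmd k V M L T :=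
  fold_cmd k (Var V) (EPair EZero ENil)
   (let_cmd k.+3 (lookup_cmd k.+3 k.+2 M L T)
   (let_cmd k.+4 (Query k.+4 (idx (Var k.+2)) (EPair ENil (ESnd (Var k.+3))))
     (Assign k.+4.+1 (EPair (EAdd (EFst (Var k)) (Var k.+4))
                            (EPair (ESnd (Var k.+3)) (ESnd (Var k))))))).

Definition best_cmd k V M Cs f :=
  fold_cmd k (Var Cs) ENil
   (let_cmd k.+3 (call_cmd k.+3 k.+2 M f)
   (let_cmd k.+4 (extend_cmd k.+4 V M k.+2 k.+3)
     (If (ELe (EFst (Var k)) (EFst (Var k.+4)))
       (Assign k.+4.+1 (Var k.+4)) (Assign k.+4.+1 (Var k))))).

Definition vertices_cmd k :=
  fold_cmd k (EFst (ESnd (Var 0))) (EPair (EPair ENil EZero) ENil)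
   (Assign k.+3 (EPair
     (EPair (EPair ENil (EFst (EFst (Var k)))) (incr (ESnd (EFst (Var k)))))
     (EPair (EPair (EFst (EFst (Var k))) (EPair (ESnd (EFst (Var k))) (Var k.+2)))
            (ESnd (Var k))))).

Definition best_class_cmd Delta f :=
  Seq (let_cmd 1 (Assign 1 (ESnd (EFst (Var 0))))
      (let_cmd 2 (let_cmd 2 (vertices_cmd 2) (Assign 3 (ESnd (Var 2))))
      (let_cmd 3 (colour_cmd 3 Delta.*2 2)
      (let_cmd 4 (best_cmd 4 2 1 3 f)
        (Assign 5 (ESnd (Var 4)))))))
    (Assign 0 (Var 1)).

Definition call_cost n f t := (5 * n + t * (3 * n + 10) + cmd_bound f + 10)%N.
Definition extend_cost n := (n * (8 * n + 20) + 3)%N.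
Definition best_cost n K f t :=
  (K * (call_cost n f t + extend_cost n + 10) + 3)%N.
Definition total_cost n Delta f t :=
  (5 * n + colour_cost n Delta.*2 + best_cost n Delta.*2.+1 f t + 30)%N.

Section Redirect.
Variables (R : realType) (n : nat) (ask : 'I_n -> data R -> data R).
Variables (E : rel 'I_n) (C : seq 'I_n).

Lemma exec_walk k (l : seq (data R)) j S :
  S k = code_nat R j -> S k.+1 = code_list l ->
  exists S' t, [/\ exec ask (While (Var k) (Seq (Assign k (ESnd (Var k)))
        (Assign k.+1 (ESnd (Var k.+1))))) S S' t, (t <= 3 * j + 1)%N,
    S' k.+1 = code_list (drop j l) & forall y, y != k -> y != k.+1 -> S' y = S y].
Proof.
elim: j l S => [|j IH] l S Sk Sk1.
  exists S, 1%N; split=> //; last by rewrite drop0.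
  by apply: exec_while_false; rewrite /= Sk.
pose S1 := set_var S k (code_nat R j).
pose S2 := set_var S1 k.+1 (code_list (behead l)).
have [||S' [t [x b v H]]] := IH (behead l) S2.
- by rewrite /S2 set_var_neq /S1 ?set_var_eq //; lia.
- by rewrite /S2 set_var_eq.
exists S', ((1 + 1) + t).+1; split.
- apply: exec_while_true x; first by rewrite /= Sk.
  apply: exec_seq; first by apply: exec_assign.
  rewrite [eval S _]/= Sk -/S1.
  have -> : S2 = set_var S1 k.+1 (eval S1 (ESnd (Var k.+1))).
    by rewrite /S2 /= {3}/S1 set_var_neq ?Sk1; [case: (l)|lia].
  exact: exec_assign.
- lia.
- by rewrite v -drop1 drop_drop addn1.
- by move=> y yk yk1; rewrite H // /S2 /S1 !set_var_neq.
Qed.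

(** A source step costs at most one walk along the class, hence the factor linear in [n]. The list
    in [L] survives because only registers from [k] on are written. *)
Lemma exec_redirect k L c B s s' t S :
  exec (fun j => ask (tnth (in_tuple C) j)) c s s' t ->
  (size C <= n)%N -> (L < k)%N -> S L = code_vertices R E C ->
  (cmd_bound c <= B)%N -> shifted k.+2 B s S ->
  exists S' t', [/\ exec ask (redirect k L c) S S' t',
    (t' <= t * (3 * n + 10))%N, shifted k.+2 B s' S' & agree k S S'].
Proof.
move=> H sC Lk; elim: H S => {c s s' t}.
- move=> s S SL _ HS; exists S, 1%N; split=> //; last lia.
  exact: exec_skip.
- move=> x e s S SL /=; rewrite geq_max => /andP[_ eB] HS.
  exists (set_var S (k.+2 + x) (eval S (shift_expr k.+2 e))), 1%N; split.
  + exact: exec_assign.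
  + lia.
  + by rewrite (eval_shift HS eB); apply: shifted_set.
  + by apply: agree_set => //; lia.
- move=> x e1 e2 s j He S SL /=; rewrite !geq_max => /and3P[_ e1B e2B] HS.
  pose S1 := set_var S k (code_nat R j).
  pose S2 := set_var S1 k.+1 (code_vertices R E C).
  have [||S3 [t3 [x3 b3 v3 A3]]] := @exec_walk k (map (@code_vertex R n E) C) j S2.
  + by rewrite /S2 set_var_neq /S1 ?set_var_eq //; lia.
  + by rewrite /S2 set_var_eq.
  have A3' y : y != k -> y != k.+1 -> S3 y = S y.
    by move=> yk yk1; rewrite A3 // /S2 /S1 !set_var_neq.
  have HS3 : shifted k.+2 B s S3 by move=> y yB; rewrite A3' ?HS //; lia.
  exists (set_var S3 (k.+2 + x)
    (ask (tnth (in_tuple C) j) (eval S3 (shift_expr k.+2 e2)))).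
  exists (1 + (1 + (t3 + 1)))%N; split.
  + apply: exec_seq; first exact: exec_assign.
    rewrite (eval_shift HS e1B) He -/S1.
    apply: exec_seq; first exact: exec_assign.
    have -> : eval S1 (Var L) = code_vertices R E C.
      by rewrite /= /S1 set_var_neq //; lia.
    rewrite -/S2; apply: exec_seq x3 _; apply: exec_query.
    rewrite /= v3 (drop_nth Nil) ?size_map //= (nth_map (tnth (in_tuple C) j)) //=.
    by rewrite {2}(tnth_nth (tnth (in_tuple C) j)).
  + have := ltn_ord j; lia.
  + by rewrite (eval_shift HS3 e2B); apply: shifted_set.
  + by move=> y yk; rewrite set_var_neq ?A3' //; lia.
- move=> c1 c2 s s1 s2 t1 t2 _ IH1 _ IH2 S SL /=.
  rewrite geq_max => /andP[c1B c2B] HS.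
  have [S1 [t1' [x1 b1 H1 A1]]] := IH1 S SL c1B HS.
  have [|S2 [t2' [x2 b2 H2 A2]]] := IH2 S1 _ c2B H1; first by rewrite A1.
  exists S2, (t1' + t2')%N; split=> //.
  + exact: exec_seq x1 x2.
  + lia.
  + exact: agree_trans A1 A2.
- move=> e c1 c2 s s' t He _ IH S SL /=.
  rewrite !geq_max => /and3P[eB c1B c2B] HS.
  have [S1 [t1' [x1 b1 H1 A1]]] := IH S SL c1B HS.
  exists S1, t1'.+1; split=> //; last lia.
  by apply: exec_if_true => //; rewrite (eval_shift HS).
- move=> e c1 c2 s s' t He _ IH S SL /=.
  rewrite !geq_max => /and3P[eB c1B c2B] HS.
  have [S1 [t1' [x1 b1 H1 A1]]] := IH S SL c2B HS.
  exists S1, t1'.+1; split=> //; last lia.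
  by apply: exec_if_false => //; rewrite (eval_shift HS).
- move=> e c s He S SL /=; rewrite geq_max => /andP[eB cB] HS.
  exists S, 1%N; split=> //; last lia.
  by apply: exec_while_false; rewrite (eval_shift HS).
- move=> e c s s1 s2 t1 t2 He _ IH1 _ IH2 S SL /= cB0 HS.
  have := cB0; rewrite geq_max => /andP[eB cB].
  have [S1 [t1' [x1 b1 H1 A1]]] := IH1 S SL cB HS.
  have [|S2 [t2' [x2 b2 H2 A2]]] := IH2 S1 _ cB0 H1; first by rewrite A1.
  exists S2, (t1' + t2').+1; split=> //.
  + by apply: exec_while_true x1 x2; rewrite (eval_shift HS).
  + lia.
  + exact: agree_trans A1 A2.
Qed.

Lemma exec_reset o B S :
  exists S' t, [/\ exec ask (reset o B) S S' t, (t <= B + 1)%N,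
    shifted o B (fun=> Nil) S' & agree o S S'].
Proof.
elim: B => [|B [S1 [t [x b H A]]]].
  by exists S, 1%N; split=> //; apply: exec_skip.
exists (set_var S1 (o + B) Nil), (t + 1)%N; split.
- by apply: exec_seq x _; apply: exec_assign.
- lia.
- move=> y; rewrite ltnS leq_eqVlt => /predU1P[->|yB]; first by rewrite set_var_eq.
  by rewrite set_var_neq ?H //; lia.
- by apply: agree_set => //; lia.
Qed.

End Redirect.

(** * Computing the best class *)

(** The unary item count in the input thus doubles as the code of the empty bundle, given to bidders
    outside the class. *)
Lemma code_set0 (R : realType) m : code_set R (@set0 'I_m) = code_nat R m.
Proof.
rewrite /code_set -[in RHS](size_enum_ord m).
by elim: (enum 'I_m) => //= k l ->; rewrite inE.
Qed.

Section Rule.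
Variables (R : realType) (Q : query_model R) (n m : nat) (v : profile R n m).
Variables (E : rel 'I_n) (f : cmd) (F : plain_rule R).
Arguments F : clear implicits.
Arguments Q : clear implicits.
Hypothesis hQ : has_value_queries Q.

Local Notation ask := (fun i => Q m (v i)).
Local Notation cv := (@code_vertex R n E).
Local Notation cl := (@code_vertices R n E).
Local Notation comp := (comp ask).

Lemma comp_call k s x y C t :
  (x < k)%N -> (y < k)%N -> s x = cl C -> s y = code_nat R m -> (size C <= n)%N ->
  run Q f (subprofile v C) (code_plain R (size C) m)
    (code_bundles R (F (size C) m (subprofile v C))) t ->
  comp k (call_cmd k x y f) s (call_cost n f t)
    (code_bundles R (F (size C) m (subprofile v C))).
Proof.
move=> xk yk sx sy sC [sf Hf Hout].
apply: (@compW _ _ _ _ _ _ (n * (1 + 4) + 3 +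
   ((cmd_bound f).+1 + 1 + (1 + (t * (3 * n + 10) + 1))) + 1)).
  by rewrite /call_cost; lia.
apply: (@comp_let _ _ _ _ _ _ _ _ _ (code_nat R (size C))).
  have -> : size C = foldl (fun a (_ : 'I_n) => a.+1) 0%N C.
    by elim/last_ind: (C) => [|l u IH] //; rewrite foldl_rcons size_rcons IH.
  apply: (@compW _ _ _ _ _ _ (size C * (1 + 4) + 3)); first by lia.
  apply: (@comp_fold _ _ _ _ _ (code_nat R) cv _ (fun _ _ => True)) => //.
  move=> u r a s' _ _ va _; split=> //.
  by apply: comp_assign; rewrite /= va.
move=> s1 A1 v1.
have [s2 [t2 [x2 b2 H2 A2]]] := exec_reset ask k.+3 (cmd_bound f).+1 s1.
pose s3 := set_var s2 k.+3 (code_plain R (size C) m).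
have A3 : agree k.+3 s1 s3 by apply: agree_set.
have H3 : shifted k.+3 (cmd_bound f).+1
    (init_store (code_plain R (size C) m)) s3.
  by rewrite /s3 -{2}[k.+3]addn0; apply: shifted_set.
have [||||s4 [t4 [x4 b4 H4 A4]]] :=
  @exec_redirect _ _ ask E C k.+1 x f (cmd_bound f).+1 _ _ _ s3 Hf sC => //.
- by lia.
- by rewrite A3 ?A1 //; lia.
exists (set_var s4 k.+1 (s4 k.+3)), (t2 + (1 + (t4 + 1)))%N; split.
- apply: exec_seq x2 _; apply: exec_seq; first exact: exec_assign.
  have -> : eval s2 (EPair (Var k) (Var y)) = code_plain R (size C) m.
    by rewrite /= !A2 ?v1 ?A1 ?sy //; lia.
  by rewrite -/s3; apply: exec_seq x4 _; apply: exec_assign.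
- lia.
- by rewrite set_var_eq -Hout -H4 ?addn0.
- apply: agree_set => //; apply: agree_trans (agreeW _ A3) A4; lia.
Qed.

Definition lookup_step (i : 'I_n) (a : seq {set 'I_m} * {set 'I_m}) (u : 'I_n) :=
  (behead a.1, if u == i then head set0 a.1 else a.2).

Lemma lookup_extend C (T : bundles (size C) m) i : uniq C ->
  (foldl (lookup_step i) ([seq T j | j <- enum 'I_(size C)], set0) C).2
    = extend T i.
Proof.
move=> uC; set ts := map _ _.
suff H : forall (D : seq 'I_n) l A, size l = size D -> uniq D ->
    (foldl (lookup_step i) (l, A) D).2 =
    if i \in D then nth set0 l (index i D) else A.
  rewrite H //; last by rewrite size_map size_enum_ord.
  case: ifPn => iC; last by rewrite extend_out.
  have [j ->] := tnthP (in_tuple C) i iC; rewrite extend_tnth //.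
  rewrite [X in index X _](tnth_nth i) index_uniq //.
  by rewrite (nth_map j) ?size_enum_ord // nth_ord_enum.
elim=> [|u D IH] [|B l] A //= [sl] /andP[uD Hu].
rewrite IH // inE eq_sym; case: (eqVneq u i) => [<-|] //=.
by rewrite (negbTE uD).
Qed.

Definition code_lookup (a : seq {set 'I_m} * {set 'I_m}) : data R :=
  Pair (code_list (map (@code_set R m) a.1)) (code_set R a.2).

Lemma comp_lookup k s w x y z i C (T : bundles (size C) m) :
  (w < k)%N -> (x < k)%N -> (y < k)%N -> (z < k)%N ->
  s w = cv i -> s x = code_nat R m -> s y = cl C -> s z = code_bundles R T ->
  comp k (lookup_cmd k w x y z) s (size C * (3 + 4) + 3)
   (code_lookup
     (foldl (lookup_step i) ([seq T j | j <- enum 'I_(size C)], set0) C)).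
Proof.
move=> wk xk yk zk sw sx sy sz.
apply: (@comp_fold _ _ _ _ _ code_lookup cv _
  (fun r a => size a.1 = size r)) => //.
- by move=> s' A; rewrite /= !A // sx sz /code_lookup /= code_set0 -map_comp.
- by rewrite size_map size_enum_ord.
move=> u r [l B] s' /= sl A va vu; split; last by rewrite size_behead sl.
case: l sl va => // D l _ va.
have s'w : s' w = cv i by rewrite A.
have eq_ui : (u == i) = (u <= i)%N && (i <= u)%N by rewrite -eqn_leq.
rewrite /lookup_step eq_ui.
apply: comp_if => /=; rewrite vu s'w /= ler_nat truthy_code_bool => H1.
  apply: comp_if => /=; rewrite vu s'w /= ler_nat truthy_code_bool => H2;
  by apply: comp_assign; rewrite /= va H1 ?H2 ?(negbTE H2).
apply: (@compW _ _ _ _ _ _ 1) => //.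
by apply: comp_assign; rewrite /= va (negbTE H1).
Qed.

Definition extend_step (S : bundles n m) (a : R * seq {set 'I_m}) i :=
  (a.1 + (v i (S i))%:num, S i :: a.2).

Definition code_extend (a : R * seq {set 'I_m}) : data R :=
  Pair (Num a.1) (code_list (map (@code_set R m) a.2)).

Definition code_scored (S : bundles n m) : data R :=
  Pair (Num (welfare (@plain_value R n m) v S)) (code_bundles R S).

Lemma extend_foldl S :
  code_extend (foldl (extend_step S) (0, [::]) (rev (enum 'I_n))) = code_scored S.
Proof.
have -> : foldl (extend_step S) (0, [::]) (rev (enum 'I_n)) =
    (\sum_(i <- enum 'I_n) (v i (S i))%:num, map S (enum 'I_n)).
  elim: (enum 'I_n) => [|i l IH]; first by rewrite big_nil.
  by rewrite rev_cons foldl_rcons IH big_cons /extend_step /= addrC.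
by rewrite /code_extend /= -map_comp big_enum.
Qed.

Lemma comp_extend k s w x y z C (T : bundles (size C) m) :
  (w < k)%N -> (x < k)%N -> (y < k)%N -> (z < k)%N -> uniq C -> (size C <= n)%N ->
  s w = cl (rev (enum 'I_n)) -> s x = code_nat R m -> s y = cl C ->
  s z = code_bundles R T ->
  comp k (extend_cmd k w x y z) s (extend_cost n) (code_scored (extend T)).
Proof.
move=> wk xk yk zk uC sC sw sx sy sz.
apply: (@compW _ _ _ _ _ _ (size (rev (enum 'I_n)) *
  (size C * (3 + 4) + 3 + (1 + 1 + 1) + 1 + 4) + 3)).
  by rewrite /extend_cost size_rev size_enum_ord; nia.
rewrite -extend_foldl.
apply: (@comp_fold _ _ _ _ _ code_extend cv _ (fun _ _ => True)) => //.
move=> i r [c l] s' _ A va vi; split=> //.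
apply: comp_let.
  by apply: (@comp_lookup _ _ _ _ _ _ i C T) => //; rewrite ?A //; lia.
rewrite /code_lookup lookup_extend // => s1 A1 v1.
apply: comp_let.
  apply: (@comp_query _ _ _ _ _ _ _ i); first by rewrite /= A1 ?vi //; lia.
  by rewrite /= v1 hQ.
move=> s2 A2 v2; apply: comp_assign.
have e1 : s2 k = s' k by rewrite A2 ?A1 //; lia.
have e2 : s2 k.+3 = s1 k.+3 by rewrite A2.
by rewrite /= v2 e1 e2 va v1.
Qed.

Definition code_best (a : option (bundles n m)) : data R :=
  if a is Some B then code_scored B else Nil.

Lemma comp_best k s x y z Cs t :
  (x < k)%N -> (y < k)%N -> (z < k)%N ->
  s x = cl (rev (enum 'I_n)) -> s y = code_nat R m -> s z = code_classes R E Cs ->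
  (forall C, C \in Cs -> uniq C) ->
  (forall C, C \in Cs -> exists2 t', (t' <= t)%N &
    run Q f (subprofile v C) (code_plain R (size C) m)
      (code_bundles R (F (size C) m (subprofile v C))) t') ->
  comp k (best_cmd k x y z f) s (best_cost n (size Cs) f t)
   (code_best (foldl (better v) None [seq class_bundles F v C | C <- Cs])).
Proof.
move=> xk yk zk sx sy sz uCs Ht.
have -> : foldl (better v) None [seq class_bundles F v C | C <- Cs] =
    foldl (fun a C => better v a (class_bundles F v C)) None Cs.
  by elim: (Cs) None => //= C Ds IH a; rewrite IH.
apply: (@compW _ _ _ _ _ _ (size Cs *
  (call_cost n f t + (extend_cost n + 2 + 1) + 1 + 4) + 3)).
  by rewrite /best_cost leq_add2r leq_mul2l; apply/orP; right; lia.
apply: (@comp_fold _ _ _ _ _ code_best cl _ (fun r _ => {subset r <= Cs})) => //.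
move=> C r a s' sub A va vC; split; last first.
  by move=> D Dr; apply: sub; rewrite inE Dr orbT.
have CC : C \in Cs by apply: sub; rewrite mem_head.
have uC := uCs C CC; have [t' tt Hrun] := Ht C CC.
have sC : (size C <= n)%N.
  by rewrite -[n in leqRHS]card_ord -(card_uniqP uC) max_card.
apply: comp_let.
  apply: (@compW _ _ _ _ _ _ (call_cost n f t')).
    by rewrite /call_cost; nia.
  by apply: (@comp_call _ _ _ _ C t') => //; rewrite ?A //; lia.
move=> s1 A1 v1; apply: comp_let.
  apply: (@comp_extend _ _ _ _ _ _ C (F (size C) m (subprofile v C))) => //;
  by [lia | rewrite A1 ?vC //; lia | rewrite A1 ?A //; lia].
move=> s2 A2 v2.
have e1 : s2 k = s' k by rewrite A2 ?A1 //; lia.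
apply: comp_if; rewrite /= v2 e1 va /= truthy_code_bool.
  case: a {va} => [B|] /= H; apply: comp_assign; rewrite /= ?v2 //.
  by rewrite /= H.
case: a va => [B|] va /= H; apply: comp_assign; rewrite /= ?e1 ?va ?(negbTE H) //.
(* In the program, [None] reads as welfare 0, and no candidate falls below 0. *)
by case/negP: H; apply: sumr_ge0 => i _; rewrite /plain_value.
Qed.

Definition code_listing (a : nat * seq 'I_n) : data R :=
  Pair (Pair (code_nat R a.1) (Num a.1%:R)) (cl a.2).

Lemma comp_vertices k (EI : rel 'I_m) s :
  (0 < k)%N -> s 0%N = code_conflict R E EI ->
  comp k (let_cmd k (vertices_cmd k) (Assign k.+1 (ESnd (Var k)))) s (5 * n + 5)
    (cl (rev (enum 'I_n))).
Proof.
move=> k0 s0.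
pose step (a : nat * seq 'I_n) i := (a.1.+1, i :: a.2).
have e : foldl step (0%N, [::]) (enum 'I_n) = (n, rev (enum 'I_n)).
  suff -> : forall l a b, foldl step (a, b) l = (a + size l, catrev l b)%N.
    by rewrite size_enum_ord.
  by elim=> [|i l IH] a b /=; rewrite ?addn0 // IH addnS.
apply: (@compW _ _ _ _ _ _ (size (enum 'I_n) * (1 + 4) + 3 + 1 + 1)).
  by rewrite size_enum_ord; lia.
apply: (@comp_let _ _ _ _ _ _ _ _ _ (code_listing (n, rev (enum 'I_n)))); last first.
  by move=> s1 A1 v1; apply: comp_assign; rewrite /= v1.
rewrite -e.
(* The invariant identifies the counter with the index of the next row. *)
apply: (@comp_fold _ _ _ _ _ code_listing
  (fun i => code_set R [set j | E i j]) step
  (fun r a => map val r = iota a.1 (size r))) => //=.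
- by rewrite s0.
- by rewrite val_enum_ord size_enum_ord.
move=> i r [a l] s' /= [ia ra] A va vi; split=> //.
by apply: comp_assign; rewrite /= va vi /= natr1 -ia.
Qed.

Lemma best_class_run (EI : rel 'I_m) Delta t :
  bidder_graph Delta E ->
  (forall C, C \in classes E Delta -> exists2 t', (t' <= t)%N &
    run Q f (subprofile v C) (code_plain R (size C) m)
      (code_bundles R (F (size C) m (subprofile v C))) t') ->
  exists2 t', (t' <= total_cost n Delta f t)%N &
    run Q (best_class_cmd Delta f) v (code_conflict R E EI)
      (code_bundles R (best_class_rule F Delta E EI v)) t'.
Proof.
move=> HE Ht; have [sC pC iC uC] := classesP HE.
set s := init_store (code_conflict R E EI).
have [s1 [t1 [x1 b1 v1 A1]]] : comp 1
   (let_cmd 1 (Assign 1 (ESnd (EFst (Var 0))))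
      (let_cmd 2 (let_cmd 2 (vertices_cmd 2) (Assign 3 (ESnd (Var 2))))
      (let_cmd 3 (colour_cmd 3 Delta.*2 2)
      (let_cmd 4 (best_cmd 4 2 1 3 f)
        (Assign 5 (ESnd (Var 4))))))) s
   (1 + (5 * n + 5 + (colour_cost n Delta.*2 +
      (best_cost n Delta.*2.+1 f t + 1 + 1) + 1) + 1) + 1)
   (code_bundles R (best_class_rule F Delta E EI v)).
  apply: comp_let; first exact: comp_assign.
  move=> s1 A1 v1; apply: comp_let.
    by apply: (@comp_vertices _ EI) => //; rewrite A1.
  move=> s2 A2 v2; apply: comp_let.
    apply: (@comp_colour _ _ _ E _ _ _ _ (rev (enum 'I_n))) => //.
    - by rewrite rev_uniq enum_uniq.
    - by rewrite size_rev size_enum_ord.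
  move=> s3 A3 v3; apply: comp_let.
    rewrite -sC; apply: (@comp_best _ _ _ _ _ (classes E Delta) t) => //.
    - by rewrite A3.
    - by rewrite A3 // A2 // v1.
  move=> s4 A4 v4; apply: comp_assign; rewrite /= v4.
  rewrite /best_class_rule /best; case e : foldl => [S|] //.
  (* At least one class exists, so the fold cannot end in [None]. *)
  have : (0 < size [seq class_bundles F v C | C <- classes E Delta])%N.
    by rewrite size_map sC.
  case: map e => //= S Ss e _; exfalso; move: e.
  by elim: Ss S => //= S' Ss IH S; case: ifP => _; apply: IH.
exists (t1 + 1)%N; first by rewrite /total_cost; lia.
exists (set_var s1 0%N (s1 1%N)); last by rewrite set_var_eq.
by apply: exec_seq x1 _; apply: exec_assign.
Qed.

End Rule.

(** * Polynomial running time *)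

Lemma run_det (R : realType) (Q : query_model R) P n m (v : profile R n m)
    input out1 out2 t1 t2 :
  run Q P v input out1 t1 -> run Q P v input out2 t2 -> out1 = out2 /\ t1 = t2.
Proof.
move=> [s1 H1 <-] [s2 H2 <-].
by have [-> ->] := exec_det H1 H2.
Qed.

(** Without a polynomial bound, [f] is only known to halt on each sub-auction separately; finitely
    many classes still give a common time, enough for correctness. *)
Lemma uniform_bound (T : eqType) (P : T -> nat -> Prop) (l : seq T) :
  (forall x, exists t, P x t) ->
  exists t, forall x, x \in l -> exists2 t', (t' <= t)%N & P x t'.
Proof.
move=> H; elim: l => [|x l [t Ht]]; first by exists 0%N.
have [u Hu] := H x; exists (maxn u t) => y.
rewrite inE => /predU1P[->|/Ht[t' tt Pt]]; first by exists u; rewrite ?leq_maxl.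
by exists t' => //; rewrite leq_max tt orbT.
Qed.

(** Natural coefficients make the polynomial monotone, which carries the time bound of [f] from
    [size C + m] to [n + m]. *)
Lemma horner_nat_mono (p : {poly nat}) (a b : nat) :
  (a <= b)%N -> (p.[a] <= p.[b])%N.
Proof.
move=> ab; elim/poly_ind: p => [|p c IH]; first by rewrite !horner0.
rewrite !hornerD !hornerM !hornerX !hornerC.
by apply: leq_add => //; apply: leq_mul.
Qed.

Definition polynomial_fun (g : nat -> nat) : Prop :=
  exists p : {poly nat}, forall N, g N = p.[N].

Lemma polynomial_fun_const c : polynomial_fun (fun=> c).
Proof. by exists c%:P => N; rewrite hornerC. Qed.

Lemma polynomial_fun_id : polynomial_fun id.
Proof. by exists 'X => N; rewrite hornerX. Qed.

Lemma polynomial_fun_add g h : polynomial_fun g -> polynomial_fun h ->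
  polynomial_fun (fun N => g N + h N)%N.
Proof. by move=> [p Hp] [q Hq]; exists (p + q) => N; rewrite hornerD -Hp -Hq. Qed.

Lemma polynomial_fun_mul g h : polynomial_fun g -> polynomial_fun h ->
  polynomial_fun (fun N => g N * h N)%N.
Proof. by move=> [p Hp] [q Hq]; exists (p * q) => N; rewrite hornerM -Hp -Hq. Qed.

Lemma total_cost_mono n N Delta f t :
  (n <= N)%N -> (total_cost n Delta f t <= total_cost N Delta f t)%N.
Proof.
move=> nN; rewrite /total_cost /best_cost /call_cost /extend_cost /colour_cost
  /place_cost /peel_cost /search_cost /hits_cost.
by repeat first [exact: leqnn | exact: nN | apply: leq_add | apply: leq_mul].
Qed.

Lemma total_cost_polynomial Delta f (p : {poly nat}) :
  polynomial_fun (fun N => total_cost N Delta f p.[N]).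
Proof.
rewrite /total_cost /best_cost /call_cost /extend_cost /colour_cost
  /place_cost /peel_cost /search_cost /hits_cost.
repeat first [exact: polynomial_fun_const | exact: polynomial_fun_id
  | by exists p | apply: polynomial_fun_add | apply: polynomial_fun_mul].
Qed.

Theorem theorem1 (R : realType) (Q : query_model R) (hQ : has_value_queries Q)
    (Delta : nat) (hDelta : (1 <= Delta)%N)
    (alpha : nat -> R) (halpha : forall m, 1 <= alpha m)
    (f : cmd) (F : plain_rule R)
    (hf : computes_plain Q f F)
    (hF : forall n m, approximates (@plain_value R n m) (alpha m) (F n m)) :
  exists (fc : cmd) (Fc : conflict_rule R),
    [/\ computes_conflict Q Delta fc Fc,
        polytime_plain Q f -> polytime_conflict Q Delta fc,
        forall n m (E : rel 'I_n) (EI : rel 'I_m), bidder_graph Delta E ->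
          approximates (conflict_value E EI)
            (16%:R * Delta%:R * alpha m / 3%:R) (Fc n m E EI)
      & (forall n m, maximal_in_range (@plain_value R n m) (F n m)) ->
        forall n m (E : rel 'I_n) (EI : rel 'I_m), bidder_graph Delta E ->
          maximal_in_range (conflict_value E EI) (Fc n m E EI) /\
          truthful (conflict_value E EI) (Fc n m E EI)].
Proof.
exists (best_class_cmd Delta f), (best_class_rule F Delta); split.
- move=> n m E EI v HE.
  have [t Ht] := uniform_bound (classes E Delta)
    (fun C : seq 'I_n => hf _ _ (subprofile v C)).
  by have [t' _ Hrun] := best_class_run hQ EI HE Ht; exists t'.
- move=> [p Hp]; have [q Hq] := total_cost_polynomial Delta f p.
  exists q => n m E EI v HE.
  have [_ _ _ uC] := classesP HE.
  have [C CC|t' tt Hrun] :=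
    @best_class_run R Q n m v E f F hQ EI Delta p.[(n + m)%N] HE.
    have [out [t [Hrun tp]]] := Hp _ _ (subprofile v C).
    have [t0 Hrun0] := hf _ _ (subprofile v C).
    (* The time bound concerns some run of [f] and correctness another; determinism identifies
       them. *)
    have [eo et] := run_det Hrun Hrun0; subst.
    exists t0 => //; apply: leq_trans tp _; apply: horner_nat_mono.
    by rewrite leq_add2r -[n in leqRHS]card_ord -(card_uniqP (uC C CC)) max_card.
  exists (code_bundles R (best_class_rule F Delta E EI v)), t'; split=> //.
  rewrite -Hq; apply: leq_trans tt _; apply: total_cost_mono; exact: leq_addr.
- by move=> n m E EI HE; apply: best_class_approx.
move=> hM n m E EI HE; have HM := best_class_maximal EI hM HE.
by split=> //; apply: maximal_in_range_truthful.
Qed.
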